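(* Let $\mathfrak g$ be one of the complex Lie superalgebras $\mathfrak{sl}(m/n)$ with $m,n\ge 1$, $m\neq n$, or $\mathfrak{osp}(2/2n)$ with $n\ge 1$, with grading $\mathfrak g=\mathfrak g_{-1}\oplus\mathfrak g_0\oplus\mathfrak g_1$, $\mathfrak g_0=\mathfrak s\oplus\mathbb C Y$. Let $K(a,y)$ be any finite-dimensional Kac module of $\mathfrak g$, typical or atypical (that is, $a$ is any dominant integral weight of $\mathfrak s$ and $y\in\mathbb C$ is arbitrary), let $D=\dim K(a,y)$, and let $\rho_y$ be the corresponding representation by $D\times D$ matrices. For $u\in\mathfrak g_1$ let $\rho'(u)=\partial_y\rho_y(u)$ be the derivative with respect to the hypercharge. For every integer $N\ge1$ define the linear map $R_N:\mathfrak g\to \mathrm{Mat}_{ND}(\mathbb C)$ by $N\times N$ block matrices with blocks of size $D\times D$ as follows: - for $x\in\mathfrak s\oplus\mathfrak g_{-1}$, $R_N(x)$ is block diagonal with all diagonal blocks equal to $\rho_y(x)$; - $R_N(Y)$ has all diagonal blocks equal to $\rho_y(Y)$, all blocks immediately above the diagonal (positions $(k,k+1)$) equal to the identity matrix $I_D$, and all other blocks zero; - for $u\in\mathfrak g_1$, $R_N(u)$ has all diagonal blocks equal to $\rho_y(u)$, all blocks immediately above the diagonal equal to $\rho'(u)$, and all other blocks zero. Then $R_N$ is an indecomposable representation of $\mathfrak g$ of dimension $ND$ which recursively embeds $N$ replications of the original Kac module: for each $1\le k\le N$ the subspace $W_k$ spanned by the first $k$ blocks is a submodule on which $\mathfrak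 g$ acts by $R_k$, and, with $W_0=0$, each quotient $W_k/W_{k-1}$ is isomorphic to $K(a,y)$.
   Context: Here $\mathfrak g$ is $\mathfrak{sl}(m/n)$ ($m\ne n$) or $\mathfrak{osp}(2/2n)$ over $\mathbb C$. Its even part is $\mathfrak g_0=\mathfrak s\oplus\mathbb C Y$, where $\mathfrak s$ is semisimple ($\mathfrak s=\mathfrak{sl}(m)\oplus\mathfrak{sl}(n)$, respectively $\mathfrak{sp}(2n)$) and $Y$ (the hypercharge) is central in $\mathfrak g_0$. Its odd part is $\mathfrak g_{-1}\oplus\mathfrak g_1$, where $[Y,u]=u$ for $u\in\mathfrak g_1$ (odd raising generators), $[Y,v]=-v$ for $v\in\mathfrak g_{-1}$ (odd lowering generators), and $\{\mathfrak g_1,\mathfrak g_1\}=\{\mathfrak g_{-1},\mathfrak g_{-1}\}=0$. Kac module: for a dominant integral weight $a$ of $\mathfrak s$ (non-negative integer Dynkin labels) and $y\in\mathbb C$, let $L(a,y)$ be the finite-dimensional irreducible $\mathfrak s$-module $L(a)$ of highest weight $a$, with $Y$ acting by the scalar $y$ and $\mathfrak g_1$ acting by zero. Then $K(a,y)=\mathrm{Ind}_{\mathfrak g_0\oplus\mathfrak g_1}^{\mathfrak g}L(a,y)$. It has dimension $D=2^{\dim\mathfrak g_{-1}}\dim L(a)$ and is a highest weight module. It is not replaced by an irreducible quotient. It is called typical if it is irreducible and atypical otherwise. Matrices: as a vector space $K(a,y)=\Lambda(\mathfrak g_{-1})\otimes L(a)$. Fix a basis of the form (monomials in a basis of $\mathfrak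 g_{-1}$)$\,\otimes\,$(basis of $L(a)$), independent of $y$, and let $\rho_y(x)$ be the matrix of $x\in\mathfrak g$ acting on $K(a,y)$ in this basis. With $a$ fixed and $y$ varying, the matrices $\rho_y(x)$ for $x\in\mathfrak s\oplus\mathfrak g_{-1}$ do not depend on $y$, $\rho_y(Y)$ equals $y I_D$ plus a constant matrix, and for $u\in\mathfrak g_1$ the entries of $\rho_y(u)$ are polynomials of degree at most one in $y$, so $\rho'(u)=\partial_y\rho_y(u)$ is a matrix independent of $y$. The $\mathbb Z/2$-grading on the $ND$-dimensional space is the one of $K(a,y)$ repeated on each block. *)

(* Defs.v *)
From HB Require Import structures.
From mathcomp Require Import all_boot all_order all_algebra.
From mathcomp Require Import complex.
From mathcomp Require Import reals topology normedtype derive.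

Set Implicit Arguments.
Unset Strict Implicit.
Unset Printing Implicit Defensive.

Import Order.TTheory GRing.Theory Num.Theory.
Import numFieldNormedType.Exports.

Local Open Scope ring_scope.

(* [SL m n] is sl(m/n) and [OSP n] is osp(2/2n).  Both are realised inside      *)
(* gl(p/q), the (p + q) x (p + q) matrices with diagonal blocks even and        *)
(* off-diagonal blocks odd.                                                     *)
Inductive superalgebra := SL of nat & nat | OSP of nat.

Definition edim (g : superalgebra) : nat :=
  match g with SL m _ => m | OSP _ => 2 end.

Definition odim (g : superalgebra) : nat :=
  match g with SL _ n => n | OSP n => n + n end.

Definition admissible (g : superalgebra) : bool :=
  match g with
  | SL m n => [&& 0 < m, 0 < n & m != n]%N
  | OSP n => (0 < n)%N
  end.

Notation gl K g := ('M[K]_(edim g + odim g)).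

Section Superalgebra.
Context {K : fieldType}.

(* Component of parity [b] ([true] is odd). *)
Definition part (p q : nat) (b : bool) (x : 'M[K]_(p + q)) : 'M[K]_(p + q) :=
  if b then block_mx 0 (ursubmx x) (dlsubmx x) 0
  else block_mx (ulsubmx x) 0 0 (drsubmx x).

Definition homogeneous (p q : nat) (b : bool) (x : 'M[K]_(p + q)) : bool :=
  part b x == x.

(* Superbracket of [x] homogeneous of parity [b] and [x'] homogeneous of        *)
(* parity [c].                                                                  *)
Definition sbracket (n : nat) (b c : bool) (x x' : 'M[K]_n) : 'M[K]_n :=
  x *m x' - (-1) ^+ (b && c) *: (x' *m x).

(* Matrix of the even bilinear form F on K^(2|2n): the hyperbolic form on the   *)
(* even part (so that so(2) is diagonal), the symplectic form on the odd part.  *)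
Definition osp_form (n : nat) : 'M[K]_(2 + (n + n)) :=
  block_mx (\matrix_(i < 2, j < 2) (i != j)%:R) 0
           0 (block_mx 0 1%:M (- 1%:M) 0).

Definition sign_mx (p q : nat) (b : bool) : 'M[K]_(p + q) :=
  block_mx 1%:M 0 0 ((-1) ^+ b)%:M.

(* For osp the condition is F(x v, w) = - (-1)^(|x||v|) F(v, x w), imposed on   *)
(* both homogeneous components of x.                                            *)
Definition in_g (g : superalgebra) : pred (gl K g) :=
  match g return pred (gl K g) with
  | SL m n => fun x : 'M[K]_(m + n) => \tr (ulsubmx x) - \tr (drsubmx x) == 0
  | OSP n => fun x : 'M[K]_(2 + (n + n)) =>
      [forall b : bool, (part b x)^T *m osp_form n ==
                        - (sign_mx 2 (n + n) b *m osp_form n *m part b x)]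
  end.

(* s = sl(m) + sl(n), respectively sp(2n). *)
Definition in_s (g : superalgebra) : pred (gl K g) :=
  match g return pred (gl K g) with
  | SL m n => fun x : 'M[K]_(m + n) =>
      [&& homogeneous false x, \tr (ulsubmx x) == 0 & \tr (drsubmx x) == 0]
  | OSP n => fun x : 'M[K]_(2 + (n + n)) =>
      [&& @in_g (OSP n) x, homogeneous false x & ulsubmx x == 0]
  end.

(* For sl(m/n) this is the only element of sl(m/n) that is scalar on each       *)
(* diagonal block and satisfies [Y, u] = u for u in the upper right block.      *)
Definition hypercharge (g : superalgebra) : gl K g :=
  match g return gl K g with
  | SL m n => block_mx (n%:R / (n%:R - m%:R))%:M 0
                       0 (m%:R / (n%:R - m%:R))%:M
  | OSP n => block_mx (diag_mx (\row_(i < 2) (-1) ^+ i)) 0 0 0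
  end.

Definition in_g1 (g : superalgebra) : pred (gl K g) := fun u =>
  [&& in_g u, homogeneous true u &
      sbracket false true (hypercharge g) u == u].

Definition in_gm1 (g : superalgebra) : pred (gl K g) := fun v =>
  [&& in_g v, homogeneous true v &
      sbracket false true (hypercharge g) v == - v].

(* Simple roots of s, with the numbering of the Dynkin diagrams A_(m-1),        *)
(* A_(n-1), respectively C_n (the last root being the long one).                *)
Definition simple_root (g : superalgebra) : finType :=
  match g with
  | SL m n => ('I_m.-1 + 'I_n.-1)%type
  | OSP n => 'I_n
  end.

Definition elem_mx (n i j : nat) : 'M[K]_n :=
  \matrix_(k < n, l < n) ((k == i :> nat) && (l == j :> nat))%:R.

Definition raising (g : superalgebra) : simple_root g -> gl K g :=
  match g return simple_root g -> gl K g with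
  | SL m n => fun i => match i with
      | inl i => block_mx (elem_mx m i i.+1) 0 0 0
      | inr j => block_mx 0 0 0 (elem_mx n j j.+1)
      end
  | OSP n => fun i => block_mx 0 0 0
      (if (i.+1 < n)%N
       then block_mx (elem_mx n i i.+1) 0 0 (- elem_mx n i.+1 i)
       else block_mx 0 (elem_mx n i i) 0 0)
  end.

Definition coroot (g : superalgebra) : simple_root g -> gl K g :=
  match g return simple_root g -> gl K g with
  | SL m n => fun i => match i with
      | inl i => block_mx (elem_mx m i i - elem_mx m i.+1 i.+1) 0 0 0
      | inr j => block_mx 0 0 0 (elem_mx n j j - elem_mx n j.+1 j.+1)
      end
  | OSP n => fun i =>
      let A := if (i.+1 < n)%N then elem_mx n i i - elem_mx n i.+1 i.+1
               else elem_mx n i i in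
      block_mx 0 0 0 (block_mx A 0 0 (- A))
  end.

End Superalgebra.

Arguments in_g K g x : clear implicits.
Arguments in_s K g x : clear implicits.
Arguments in_g1 K g x : clear implicits.
Arguments in_gm1 K g x : clear implicits.

Section Modules.
Context {K : fieldType} {g : superalgebra}.

(* Maps defined on a subspace P of gl(p/q) are represented by functions on      *)
(* gl(p/q) whose values outside P are irrelevant.                               *)
Definition linear_on (P : pred (gl K g)) (V : lmodType K)
    (f : gl K g -> V) : Prop :=
  forall (a : K) x x', P x -> P x' -> f (a *: x + x') = a *: f x + f x'.

Definition is_module (P : pred (gl K g)) (M : lmodType K)
    (act : gl K g -> M -> M) : Prop :=
  [/\ forall x, P x -> linear (act x),
      forall w, linear_on P (act^~ w) &
      forall (b c : bool) x x' w, P x -> P x' ->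
        homogeneous b x -> homogeneous c x' ->
        act (sbracket b c x x') w =
          act x (act x' w) - (-1) ^+ (b && c) *: act x' (act x w)].

Definition mxact (n : nat) (rho : gl K g -> 'M[K]_n) :
    gl K g -> 'cV[K]_n -> 'cV[K]_n :=
  fun x w => rho x *m w.

Definition is_rep (P : pred (gl K g)) (n : nat) (rho : gl K g -> 'M[K]_n) :
    Prop :=
  linear_on P rho /\ is_module P (mxact rho).

(* The i-th basis vector of K^n has parity [par i]; elements of parity b shift  *)
(* parity by b.                                                                 *)
Definition respects_parity (P : pred (gl K g)) (n : nat) (par : 'I_n -> bool)
    (rho : gl K g -> 'M[K]_n) : Prop :=
  forall (b : bool) x, P x -> homogeneous b x ->
    forall i j, rho x i j != 0 -> par i = b (+) par j.

Definition homogeneous_vec (n : nat) (par : 'I_n -> bool) (b : bool)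
    (w : 'cV[K]_n) : Prop :=
  forall i, w i 0 != 0 -> par i = b.

Definition submodule (P : pred (gl K g)) (n : nat) (rho : gl K g -> 'M[K]_n)
    (U : {vspace 'cV[K]_n}) : Prop :=
  forall x w, P x -> w \in U -> rho x *m w \in U.

Definition irreducible (P : pred (gl K g)) (n : nat)
    (rho : gl K g -> 'M[K]_n) : Prop :=
  (0 < n)%N /\
  forall U, submodule P rho U -> U = 0%VS \/ U = fullv.

(* Submodules are not required to be graded, which gives the stronger notion. *)
Definition indecomposable (P : pred (gl K g)) (n : nat)
    (rho : gl K g -> 'M[K]_n) : Prop :=
  (0 < n)%N /\
  forall U V, submodule P rho U -> submodule P rho V ->
    (U + V)%VS = fullv -> (U :&: V)%VS = 0%VS -> U = 0%VS \/ V = 0%VS.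

(* K^d, with s acting by [lam], is the module L(a). *)
Definition is_irreducible_hw (a : simple_root g -> nat) (d : nat)
    (lam : gl K g -> 'M[K]_d) : Prop :=
  [/\ is_rep (in_s K g) lam, irreducible (in_s K g) lam &
      exists2 w : 'cV[K]_d, w != 0 &
        forall i, lam (raising i) *m w = 0 /\
                  lam (coroot i) *m w = (a i)%:R *: w].

(* f is a (g_0 + g_1)-homomorphism from L(a, y) to M. *)
Definition kac_hom (d : nat) (lam : gl K g -> 'M[K]_d) (y : K)
    (M : lmodType K) (act : gl K g -> M -> M) (f : 'cV[K]_d -> M) : Prop :=
  [/\ linear f,
      forall x w, in_s K g x -> f (lam x *m w) = act x (f w),
      forall w, f (y *: w) = act (hypercharge g) (f w) &
      forall u w, in_g1 K g u -> f 0 = act u (f w)].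

(* (M, iota) is the induced module Ind_(g_0 + g_1)^g L(a, y), given by its      *)
(* universal property (left adjoint of restriction).                            *)
Definition is_kac_module (d : nat) (lam : gl K g -> 'M[K]_d) (y : K)
    (M : lmodType K) (act : gl K g -> M -> M) (iota : 'cV[K]_d -> M) : Prop :=
  [/\ is_module (in_g K g) act,
      kac_hom lam y act iota &
      forall (M' : lmodType K) (act' : gl K g -> M' -> M')
             (f : 'cV[K]_d -> M'),
        is_module (in_g K g) act' -> kac_hom lam y act' f ->
        let extends (phi : M -> M') :=
          [/\ linear phi,
              forall x w, in_g K g x -> phi (act x w) = act' x (phi w) &
              forall w, phi (iota w) = f w] in
        (exists phi, extends phi) /\
        (forall phi phi', extends phi -> extends phi' -> phi =1 phi')].

Definition is_basis_gm1 (r : nat) (vs : r.-tuple (gl K g)) : Prop :=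
  free vs /\ forall x, (x \in <<vs>>%VS) = in_gm1 K g x.

(* [rho] is the matrix form of K(a, y) in the basis formed by the monomials     *)
(*   v_(k_1) ... v_(k_l) (x) w_j,   S = {k_1 < ... < k_l},                      *)
(* with w_j the standard basis of K^d.  The i-th basis vector is the one for    *)
(* which [num i = (S, j)].                                                      *)
Definition is_kac_matrices (d : nat) (lam : gl K g -> 'M[K]_d) (y : K)
    (r : nat) (vs : r.-tuple (gl K g))
    (D : nat) (num : 'I_D -> {set 'I_r} * 'I_d)
    (rho : gl K g -> 'M[K]_D) : Prop :=
  exists iota : 'cV[K]_d -> 'cV[K]_D,
    [/\ linear_on (in_g K g) rho,
        is_kac_module lam y (mxact rho) iota &
        forall i : 'I_D,
          (\prod_(k in (num i).1) rho (tnth vs k)) *m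
            iota (delta_mx (num i).2 0) = delta_mx i 0].

Definition kac_parity (d r D : nat) (num : 'I_D -> {set 'I_r} * 'I_d)
    (i : 'I_D) : bool :=
  odd #|(num i).1|.

End Modules.

Notation block_dim N D := (\sum_(k < N) (D : nat))%N.

Section Blocks.
Context {K : fieldType}.

Definition upper_block (D N : nat) (A B : 'M[K]_D) : 'M[K]_(block_dim N D) :=
  \mxblock_(k < N, l < N)
    (if k == l then A else if k.+1 == l :> nat then B else 0).

Definition block_parity (D N : nat) (par : 'I_D -> bool)
    (i : 'I_(block_dim N D)) : bool :=
  par (tagnat.sig2 i).

(* W_k, the span of the first k blocks. *)
Definition first_blocks (D N k : nat) : {vspace 'cV[K]_(block_dim N D)} :=
  <<[seq delta_mx i 0%R | i <- enum 'I_(block_dim N D) & (tagnat.sig1 i < k)%N]>>%VS.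

(* The inclusion of K^(kD) in K^(ND) as the first k blocks. *)
Definition block_incl (D k N : nat) (w : 'cV[K]_(block_dim k D)) :
    'cV[K]_(block_dim N D) :=
  \mxcol_(l < N) (if insub (val l) is Some l' then submxcol w (l' : 'I_k) else 0).

End Blocks.

Arguments first_blocks K D N k : clear implicits.
Arguments block_incl K D k N w : clear implicits.

Section Quotient.
Context {K : fieldType} {V : vectType K}.

Definition rel_sub (U U' : {vspace V}) : {pred subvs_of U} :=
  fun w => vsval w \in U'.
Arguments rel_sub : clear implicits.

Lemma rel_sub_zmod_closed (U U' : {vspace V}) : zmod_closed (rel_sub U U').
Proof.
split; first by rewrite unfold_in /rel_sub linear0 mem0v.
by move=> u v; rewrite !unfold_in /rel_sub linearB; apply: memvB.
Qed.

HB.instance Definition _ (U U' : {vspace V}) :=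
  GRing.isZmodClosed.Build (subvs_of U) (rel_sub U U')
    (rel_sub_zmod_closed U U').

(* U / U' for U' a subspace of U. *)
Definition quotient_space (U U' : {vspace V}) := Quotient.quot (rel_sub U U').

Definition qclass (U U' : {vspace V}) (w : subvs_of U) : quotient_space U U' :=
  \pi_(quotient_space U U')%qT w.

End Quotient.

Section Extension.
Context {K : numFieldType} {g : superalgebra}.

Definition rho_deriv (D : nat) (rho : K -> gl K g -> 'M[K]_D) (y : K)
    (u : gl K g) : 'M[K]_D :=
  \matrix_(i, j) derive1 (fun t : K^o => rho t u i j : K^o) y.

(* RN is R_N: as g = s + g_(-1) + K Y + g_1, these conditions determine it on g. *)
Definition is_extension (D : nat) (rho : K -> gl K g -> 'M[K]_D) (y : K)
    (N : nat) (RN : gl K g -> 'M[K]_(block_dim N D)) : Prop :=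
  [/\ linear_on (in_g K g) RN,
      forall x v, in_s K g x -> in_gm1 K g v ->
        RN (x + v) = upper_block N (rho y (x + v)) 0,
      RN (hypercharge g) = upper_block N (rho y (hypercharge g)) 1%:M &
      forall u, in_g1 K g u ->
        RN u = upper_block N (rho y u) (rho_deriv rho y u)].

(* U / U' (with g acting through [RN]) is isomorphic to K^D (with g acting      *)
(* through [rho]) by an even g-isomorphism.                                     *)
Definition quotient_iso (n D : nat)
    (parN : 'I_n -> bool) (RN : gl K g -> 'M[K]_n) (U U' : {vspace 'cV[K]_n})
    (par : 'I_D -> bool) (rho : gl K g -> 'M[K]_D) : Prop :=
  exists phi : quotient_space U U' -> 'cV[K]_D,
    [/\ bijective phi,
        forall (a : K) w w',
          phi (qclass U' (a *: w + w')) =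
            a *: phi (qclass U' w) + phi (qclass U' w'),
        forall x w, in_g K g x ->
          phi (qclass U' (vsproj U (RN x *m vsval w))) =
            rho x *m phi (qclass U' w) &
        forall b w, homogeneous_vec parN b (vsval w) ->
          homogeneous_vec par b (phi (qclass U' w))].

End Extension.

(* Main.v *)
Require Import Defs.
From HB Require Import structures.
From mathcomp Require Import all_boot all_order all_algebra.
From mathcomp Require Import complex reals ring.
From mathcomp Require Import boolp functions topology normedtype derive.

(** Since [rho t] is affine in [t], the map R_N is [rho (y + J)] with [J] a     *)
(** nilpotent Jordan block: R_N(x) has diagonal blocks [rho y x] and            *)
(** superdiagonal blocks [slope rho x] for every [x] in g.  It is a             *)
(** representation because the bracket identities of [rho (y + s)] hold for     *)
(** all [s], hence coefficientwise.  Affinity follows by moving [x] through     *)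
(** the monomials v_(k_1) ... v_(k_l).                                          *)
(**                                                                             *)
(** For indecomposability, let the module be U + V, a direct sum.  The          *)
(** eigenspace of R_N(Y) for the eigenvalue y is a single copy of L(a), on      *)
(** which s acts irreducibly, so it lies in one summand, say V, and Y - y is    *)
(** injective on U.  Hence V contains the whole generalised eigenspace, which   *)
(** generates the module under g_(-1).                                          *)

Set Implicit Arguments.
Unset Strict Implicit.
Unset Printing Implicit Defensive.

Import Order.TTheory GRing.Theory Num.Theory.

Local Open Scope ring_scope.

(** * The superalgebras *)

(** The relations of [g] hold for [rho t] at every [t], and [t] enters affinely, so the scalar [t]
    may be replaced by [y + J] with [J] the nilpotent shift of [N] blocks. To see the affinity, work
    in the monomial basis: [kac_basis_const] and [kac_s_const] show that g_(-1) and s act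
    independently of [t], [kac_hypercharge] that Y has eigenvalues [t - |S|], and [affine_g1] treats
    the raising generators; [kac_affine] assembles these. The coefficients of the bracket relations
    are separated in [slope_sbracket], which yields [extension_rep].

    The operator Y - y maps the top component of each block onto that of the preceding one
    ([extension_hypercharge_top]), and its kernel is exactly the top component of block 0
    ([extension_hypercharge_eigen]), a copy of L(a). A summand that misses this copy, when the
    complement contains it, is zero ([extension_summand]); irreducibility of L(a) excludes the other
    cases.

    The filtration is read off [blk_upper_block]: row [n] involves only blocks [n] and [n.+1], so
    the first blocks are stable and the last of them sees only [rho y]. *)

Section Parity.
Context {K : fieldType} {p q : nat}.
Implicit Types x : 'M[K]_(p + q).

Lemma evenP x : reflect (exists A D, x = block_mx A 0 0 D) (homogeneous false x).
Proof.
apply: (iffP eqP) => [<-|[A [D ->]]]; first by exists (ulsubmx x), (drsubmx x).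
by rewrite /part /= block_mxKul block_mxKdr.
Qed.

Lemma oddP x : reflect (exists B C, x = block_mx 0 B C 0) (homogeneous true x).
Proof.
apply: (iffP eqP) => [<-|[B [C ->]]]; first by exists (ursubmx x), (dlsubmx x).
by rewrite /part /= block_mxKur block_mxKdl.
Qed.

Lemma homogeneousP b x :
  reflect (exists A B C D, x = if b then block_mx 0 B C 0 else block_mx A 0 0 D)
    (homogeneous b x).
Proof.
case: b.
  apply: (iffP (oddP x)) => [[B [C ->]]|[A [B [C [D ->]]]]]; last by exists B, C.
  by exists 0, B, C, 0.
apply: (iffP (evenP x)) => [[A [D ->]]|[A [B [C [D ->]]]]]; last by exists A, D.
by exists A, 0, 0, D.
Qed.

Lemma part_linear b c x x' : part b (c *: x + x') = c *: part b x + part b x'.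
Proof.
rewrite -[x]submxK -[x']submxK !(scale_block_mx, add_block_mx) /part.
case: b; rewrite ?(block_mxKul, block_mxKur, block_mxKdl, block_mxKdr).
  by rewrite scale_block_mx add_block_mx !(scaler0, addr0).
by rewrite scale_block_mx add_block_mx !(scaler0, addr0).
Qed.

Lemma partD x : part false x + part true x = x.
Proof. by rewrite -[RHS]submxK add_block_mx !(addr0, add0r). Qed.

Lemma part_part b c x : part b (part c x) = if b == c then part c x else 0.
Proof.
case: b c => [] [];
  rewrite /part ?(block_mxKul, block_mxKur, block_mxKdl, block_mxKdr) //;
  exact: block_mx0.
Qed.

Lemma homogeneous_part b x : homogeneous b (part b x).
Proof. by rewrite /homogeneous part_part eqxx. Qed.

Lemma homogeneous_linear b c x x' :
  homogeneous b x -> homogeneous b x' -> homogeneous b (c *: x + x').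
Proof. by move=> /eqP hx /eqP hx'; rewrite /homogeneous part_linear hx hx'. Qed.

Lemma homogeneous0 b : homogeneous b (0 : 'M[K]_(p + q)).
Proof. by case: b; [apply/oddP|apply/evenP]; exists 0, 0; rewrite block_mx0. Qed.

Lemma homogeneousZ b c x : homogeneous b x -> homogeneous b (c *: x).
Proof.
by move=> hx; rewrite -[c *: x]addr0; apply/homogeneous_linear/homogeneous0.
Qed.

Lemma homogeneousD b x x' :
  homogeneous b x -> homogeneous b x' -> homogeneous b (x + x').
Proof. by move=> hx hx'; rewrite -[x]scale1r; apply: homogeneous_linear. Qed.

Lemma homogeneousB b x x' :
  homogeneous b x -> homogeneous b x' -> homogeneous b (x - x').
Proof.
by move=> hx hx'; rewrite addrC -scaleN1r; apply: homogeneous_linear.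
Qed.

Lemma homogeneous_mul b c x x' :
  homogeneous b x -> homogeneous c x' -> homogeneous (b (+) c) (x *m x').
Proof.
move=> /homogeneousP [A [B [C [D ->]]]] /homogeneousP [A' [B' [C' [D' ->]]]].
case: b c => [] [];
  rewrite mulmx_block !(mul0mx, mulmx0, addr0, add0r) /=;
  by [apply/evenP; eexists _, _ | apply/oddP; eexists _, _].
Qed.

Lemma homogeneous_sbracket b c x x' : homogeneous b x -> homogeneous c x' ->
  homogeneous (b (+) c) (sbracket b c x x').
Proof.
move=> hx hx'; rewrite /sbracket addrC -scaleNr; apply: homogeneous_linear.
  by rewrite addbC; apply: homogeneous_mul.
exact: homogeneous_mul.
Qed.

(** Carries the sign of the orthosymplectic condition past a second element; this produces the sign
    of the superbracket in [in_g_sbracket]. *)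
Lemma sign_mx_mul b c x : homogeneous c x ->
  sign_mx p q b *m x = (-1) ^+ (b && c) *: (x *m sign_mx p q b).
Proof.
case/homogeneousP => A [B [C [D ->]]]; rewrite /sign_mx.
case: b c => [] [];
  rewrite !mulmx_block scale_block_mx;
  rewrite !(mul0mx, mulmx0, mul1mx, mulmx1, addr0, add0r, scaler0);
  rewrite ?(mul_scalar_mx, mul_mx_scalar, expr0, expr1, scale1r, scaleN1r, opprK) //.
Qed.

Lemma sign_mx_tr b : (sign_mx p q b)^T = sign_mx p q b :> 'M[K]_(p + q).
Proof. by rewrite /sign_mx tr_block_mx !trmx0 !tr_scalar_mx. Qed.

Lemma sign_mxM b c :
  sign_mx p q b *m sign_mx p q c = sign_mx p q (b (+) c) :> 'M[K]_(p + q).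
Proof.
rewrite /sign_mx mulmx_block !(mulmx0, mul0mx, addr0, add0r) mulmx1.
by rewrite -scalar_mxM signr_addb.
Qed.

End Parity.

(** * Closure of [g] under linear combinations, parity components and superbracket *)

Section Algebra.
Context {K : numFieldType}.

Lemma in_g_linear g c x x' : in_g K g x -> in_g K g x' -> in_g K g (c *: x + x').
Proof.
case: g x x' => [m n|n] x x' /=.
  move=> /eqP hx /eqP hx'; rewrite -[x]submxK -[x']submxK.
  rewrite scale_block_mx add_block_mx block_mxKul block_mxKdr !mxtraceD !mxtraceZ.
  by rewrite opprD addrACA -mulrBr hx hx' mulr0 addr0.
move=> /forallP hx /forallP hx'; apply/forallP => b.
rewrite part_linear linearP /= mulmxDl -scalemxAl (eqP (hx b)) (eqP (hx' b)).
by rewrite mulmxDr -scalemxAr opprD scalerN.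
Qed.

Lemma in_g_part g b x : in_g K g x -> in_g K g (part b x).
Proof.
case: g x => [m n|n] x /=.
  move=> hx; case: b; rewrite /part ?(block_mxKul, block_mxKdr) //.
  by rewrite !mxtrace0 subrr.
move=> /forallP hx; apply/forallP => c; rewrite part_part.
by case: (c =P b) => [<-|_]; [apply: hx|rewrite trmx0 mul0mx mulmx0 oppr0].
Qed.

Lemma in_g0 g : in_g K g 0.
Proof.
case: g => [m n|n] /=.
  by rewrite -block_mx0 block_mxKul block_mxKdr !mxtrace0 subrr.
apply/forallP => b; rewrite (_ : part b 0 = 0); last first.
  by have := part_linear b (-1) (0 : 'M[K]_(2 + (n + n))) 0; rewrite !scaleN1r !addNr.
by rewrite trmx0 mul0mx mulmx0 oppr0.
Qed.

Lemma in_gZ g c x : in_g K g x -> in_g K g (c *: x).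
Proof. by move=> hx; rewrite -[c *: x]addr0; apply/in_g_linear/in_g0. Qed.

Lemma in_gD g x x' : in_g K g x -> in_g K g x' -> in_g K g (x + x').
Proof. by move=> hx hx'; rewrite -[x]scale1r; apply: in_g_linear. Qed.

Lemma in_gB g x x' : in_g K g x -> in_g K g x' -> in_g K g (x - x').
Proof. by move=> hx hx'; rewrite addrC -scaleN1r; apply: in_g_linear. Qed.

Lemma in_osp_homogeneous n b (x : gl K (OSP n)) : homogeneous b x ->
  in_g K (OSP n) x =
  (x^T *m osp_form n == - (sign_mx 2 (n + n) b *m osp_form n *m x)).
Proof.
move=> /eqP hx; apply/forallP/idP => [/(_ b)|h c]; first by rewrite hx.
rewrite -hx part_part; case: (c =P b) => [->|_]; first by rewrite hx.
by rewrite trmx0 mul0mx mulmx0 oppr0.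
Qed.

(** For sl(m/n), cyclicity of the trace kills the supertrace of a supercommutator. For osp(2/2n),
    the invariance condition is applied twice. *)
Lemma in_g_sbracket g b c (x x' : gl K g) : homogeneous b x -> homogeneous c x' ->
  in_g K g x -> in_g K g x' -> in_g K g (sbracket b c x x').
Proof.
case: g x x' => [m n|n] x x'.
  move=> /homogeneousP [A [B [C [D ->]]]] /homogeneousP [A' [B' [C' [D' ->]]]].
  have trB p (X Z : 'M[K]_p) : \tr (X - Z) = \tr X - \tr Z by exact: raddfB.
  rewrite /in_g /sbracket => _ _; case: b c => [] [] /=;
  rewrite !mulmx_block scale_block_mx opp_block_mx add_block_mx;
  rewrite block_mxKul block_mxKdr !(mul0mx, mulmx0, addr0, add0r);
  rewrite ?(expr0, expr1, scale1r, scaleN1r, opprK, scaler0, subrr, mxtrace0) //;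
  rewrite ?trB ?mxtraceD ?oppr0 ?mxtrace0 ?subrr //.
  - by rewrite (mxtrace_mulC B) (mxtrace_mulC B') [X in X - _]addrC subrr.
  - by rewrite (mxtrace_mulC A) (mxtrace_mulC D) !subrr.
move=> hx hx' gx gx'; rewrite (in_osp_homogeneous (homogeneous_sbracket hx hx')).
(* The transposes cross the form one after the other; the sign comes from commuting the first sign
   matrix past the second element. *)
have key b' c' (z z' : 'M[K]_(2 + (n + n))) :
    homogeneous b' z -> homogeneous c' z' -> in_g K (OSP n) z -> in_g K (OSP n) z' ->
    z'^T *m z^T *m osp_form n = (-1) ^+ (b' && c') *:
     (sign_mx 2 (n + n) (b' (+) c') *m osp_form n *m z' *m z).
  move=> hz hz'; rewrite (in_osp_homogeneous hz) (in_osp_homogeneous hz').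
  move=> /eqP gz /eqP gz'; rewrite -mulmxA gz mulmxN !mulmxA.
  rewrite -[z'^T *m _]trmxK trmx_mul sign_mx_tr trmxK (sign_mx_mul b' hz').
  rewrite linearZ /= trmx_mul sign_mx_tr -!scalemxAl -!mulmxA.
  rewrite (mulmxA z'^T) gz' mulNmx mulmxN scalerN opprK.
  by rewrite !mulmxA sign_mxM.
rewrite /sbracket linearB linearZ /= !trmx_mul mulmxBl -scalemxAl.
rewrite (key b c x x') // (key c b x' x) // mulmxBr -scalemxAr !mulmxA.
rewrite scalerA (andbC c) -signr_addb addbb scale1r opprB.
by rewrite (addbC c).
Qed.

End Algebra.

(** * The hypercharge and the even part *)

Section Grading.
Context {K : numFieldType}.

Local Notation Y g := (hypercharge g : gl K g).

Lemma sbracket_even n c (x x' : 'M[K]_n) :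
  sbracket false c x x' = x *m x' - x' *m x.
Proof. by rewrite /sbracket expr0 scale1r. Qed.

Lemma homogeneous_hypercharge g : homogeneous false (Y g).
Proof. by case: g => [m n|n]; apply/evenP; eexists _, _. Qed.

Lemma in_g_hypercharge g : in_g K g (Y g).
Proof.
case: g => [m n|n].
  rewrite /= block_mxKul block_mxKdr !mxtrace_scalar.
  rewrite -[X in X - _]mulr_natr -[X in _ - X]mulr_natr.
  by rewrite mulrAC [X in _ - X]mulrAC [X in X / _]mulrC subrr.
rewrite (in_osp_homogeneous (homogeneous_hypercharge (OSP n))) /=.
rewrite /osp_form /sign_mx tr_block_mx !mulmx_block opp_block_mx.
rewrite !(trmx0, mul0mx, mulmx0, addr0, add0r, oppr0) mul1mx.
apply/eqP; congr block_mx; apply/matrixP => i j.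
rewrite tr_diag_mx mul_diag_mx mul_mx_diag !mxE.
case: i j => [[|[|i]] Hi] [[|[|j]] Hj] //=; rewrite ?mulr0 ?mul0r ?oppr0 //;
  by rewrite ?(mulr1, mul1r, expr0, expr1, opprK).
Qed.

(** For sl(m/n) the two scalars of Y differ by 1, so ad Y is 1 and -1 on the two off-diagonal
    blocks. For osp(2/2n) it multiplies them, up to sign, by the involution [h]. *)
Lemma hypercharge_odd g (x : gl K g) : admissible g -> homogeneous true x ->
  let x' := Y g *m x - x *m Y g in Y g *m x' - x' *m Y g = x.
Proof.
case: g x => [m n|n] x hg /oddP [B [C ->]] /=.
  case/and3P: hg => _ _ mn.
  set a := n%:R / _; set b := m%:R / _.
  have ab : a - b = 1.
    by rewrite -mulrBl divff // subr_eq0 eqr_nat eq_sym.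
  have key (B' : 'M_(m, n)) (C' : 'M_(n, m)) :
      block_mx a%:M 0 0 b%:M *m block_mx 0 B' C' 0 -
      block_mx 0 B' C' 0 *m block_mx a%:M 0 0 b%:M = block_mx 0 B' (- C') 0.
    rewrite !mulmx_block opp_block_mx add_block_mx.
    rewrite !(mul0mx, mulmx0, addr0, add0r, subrr).
    rewrite !mul_scalar_mx !mul_mx_scalar -!scalerBl ab scale1r.
    by rewrite -(opprB a b) ab scaleN1r.
  by rewrite !key opprK.
set h := diag_mx _.
have hh : h *m h = 1%:M.
  apply/matrixP => i j; rewrite mul_diag_mx !mxE mulrnAr.
  by case: eqVneq => [->|_]; rewrite ?mulr0n // -expr2 sqrr_sign.
have key (B' : 'M_(2, n + n)) (C' : 'M_(n + n, 2)) :
    block_mx h 0 0 0 *m block_mx 0 B' C' 0 -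
    block_mx 0 B' C' 0 *m block_mx h 0 0 0 = block_mx 0 (h *m B') (- (C' *m h)) 0.
  rewrite !mulmx_block opp_block_mx add_block_mx.
  by rewrite !(mul0mx, mulmx0, addr0, add0r, subrr, oppr0).
by rewrite !key mulNmx opprK -mulmxA mulmxA hh mul1mx mulmx1.
Qed.

(** The upper left block lies in so(2) for the hyperbolic form, a line spanned by diag(1, -1). *)
Lemma in_osp_even n (A : 'M[K]_2) (B : 'M[K]_(n + n)) :
  in_g K (OSP n) (block_mx A 0 0 B) ->
  A = A 0 0 *: diag_mx (\row_(i < 2) (-1) ^+ i).
Proof.
rewrite (@in_osp_homogeneous _ n false); last by apply/evenP; exists A, B.
rewrite /osp_form /sign_mx tr_block_mx !mulmx_block opp_block_mx.
rewrite !(trmx0, mul0mx, mulmx0, addr0, add0r, oppr0) mul1mx.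
move=> /eqP /eq_block_mx [hA _ _ _].
have e i j := congr1 (fun M : 'M_2 => M i j) hA.
move: (e ord0 ord0) (e ord0 (lift ord0 ord0)) (e (lift ord0 ord0) (lift ord0 ord0)).
rewrite !mxE !big_ord_recl !big_ord0 !mxE /=.
rewrite !(mulr0, mulr1, mul0r, mul1r, addr0, add0r).
have two_eq0 (a : K) : a = - a -> a = 0.
  by move/eqP; rewrite -addr_eq0 -mulr2n mulrn_eq0 => /eqP.
move=> /two_eq0 a10 a00 /two_eq0 a01.
apply/matrixP => i j.
have ord2 (k : 'I_2) : k = ord0 \/ k = lift ord0 ord0.
  by case: (unliftP ord0 k) => [k' ->|]; [right; rewrite ord1|left].
case: (ord2 i) (ord2 j) => [] -> [] ->; rewrite !mxE /=.
- by rewrite mulr1.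
- by rewrite a01 mulr0.
- by rewrite a10 mulr0.
- by rewrite expr1 mulrN1 a00 opprK.
Qed.

Lemma in_s_in_g g x : in_s K g x -> in_g K g x.
Proof.
case: g x => [m n|n] x /=; last by case/and3P.
by case/and3P => _ /eqP -> /eqP ->; rewrite subrr.
Qed.

Lemma in_s_even g x : in_s K g x -> homogeneous false x.
Proof. by case: g x => [m n|n] x /and3P []. Qed.

Lemma even_decomposition g x : admissible g ->
  in_g K g x -> homogeneous false x ->
  exists c s, [/\ in_s K g s, x = c *: Y g + s & Y g *m x = x *m Y g].
Proof.
case: g x => [m n|n] x hg gx x0; have /evenP [A [B ex]] := x0.
  case/and3P: hg => m0 n0 mn; move: gx; rewrite ex /= block_mxKul block_mxKdr.
  rewrite subr_eq0 => /eqP trAB.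
  have nz k : (0 < k)%N -> k%:R != 0 :> K by rewrite pnatr_eq0 lt0n.
  have nm : n%:R - m%:R != 0 :> K by rewrite subr_eq0 eqr_nat eq_sym.
  (* Both diagonal blocks of Y have trace mn/(n - m), so this [c] removes the equal traces of [A]
     and [B] at once. *)
  set c := \tr A * (n%:R - m%:R) / (n%:R * m%:R).
  exists c, (block_mx A 0 0 B - c *: Y (SL m n)); split.
  - rewrite /= scale_block_mx opp_block_mx add_block_mx !scaler0 !subr0.
    rewrite block_mxKul block_mxKdr.
    apply/and3P; split; first by apply/evenP; eexists _, _.
      rewrite linearB linearZ /= mxtrace_scalar -mulr_natr subr_eq0; apply/eqP.
      rewrite /c; field.
      by rewrite nm !nz.
    rewrite linearB linearZ /= mxtrace_scalar -mulr_natr subr_eq0; apply/eqP.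
    rewrite /c trAB; field.
    by rewrite nm !nz.
  - by rewrite addrC subrK.
  - rewrite !mulmx_block !(mul0mx, mulmx0, addr0, add0r).
    by rewrite !mul_scalar_mx !mul_mx_scalar.
have eA : A = A 0 0 *: diag_mx (\row_(i < 2) (-1) ^+ i).
  by apply: (@in_osp_even n A B); rewrite -ex.
set c := A 0 0 in eA; exists c, (x - c *: Y (OSP n)); split.
- apply/and3P; split.
  + rewrite addrC -scaleNr; apply: in_g_linear => //.
    exact: in_g_hypercharge.
  + rewrite addrC -scaleNr; apply: homogeneous_linear => //.
    exact: (homogeneous_hypercharge (OSP n)).
  + rewrite ex /= scale_block_mx opp_block_mx add_block_mx block_mxKul.
    by rewrite {1}eA subrr.
- by rewrite addrC subrK.
rewrite ex /= !mulmx_block !(mul0mx, mulmx0, addr0, add0r) eA.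
by rewrite -scalemxAl -scalemxAr.
Qed.

End Grading.

(** * The odd part as a sum of eigenspaces of ad Y *)

Section OddParts.
Context {K : numFieldType} {g : superalgebra}.
Implicit Types x u v : gl K g.

Local Notation Y := (hypercharge g : gl K g).

Lemma in_g1P u : reflect
  [/\ in_g K g u, homogeneous true u & Y *m u - u *m Y = u] (in_g1 K g u).
Proof.
rewrite /in_g1 sbracket_even.
by apply: (iffP and3P) => [[? ? /eqP]|[? ? /eqP]].
Qed.

Lemma in_gm1P v : reflect
  [/\ in_g K g v, homogeneous true v & Y *m v - v *m Y = - v] (in_gm1 K g v).
Proof.
rewrite /in_gm1 sbracket_even.
by apply: (iffP and3P) => [[? ? /eqP]|[? ? /eqP]].
Qed.

Lemma ad_sub x a b : x *m (a - b) - (a - b) *m x =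
  (x *m a - a *m x) - (x *m b - b *m x).
Proof. 
rewrite mulmxBr mulmxBl !opprB -!addrA; congr (_ + _).
by rewrite addrCA [RHS]addrCA [- _ - _]addrC.
Qed.

Lemma ad_add x a b : x *m (a + b) - (a + b) *m x =
  (x *m a - a *m x) + (x *m b - b *m x).
Proof. by rewrite mulmxDr mulmxDl opprD addrACA. Qed.

Lemma ad_mul x a b : x *m (a *m b) - a *m b *m x =
  (x *m a - a *m x) *m b + a *m (x *m b - b *m x).
Proof. by rewrite mulmxBl mulmxBr !mulmxA addrA subrK. Qed.

Lemma sbracket_s_gm1 (hg : admissible g) x v :
  in_s K g x -> in_gm1 K g v -> in_gm1 K g (sbracket false true x v).
Proof.
move=> hx /in_gm1P [gv v1 hv]; have x0 := in_s_even hx; have gx := in_s_in_g hx.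
have [_ [_ [_ _ Yx]]] := even_decomposition hg gx x0.
apply/in_gm1P; split; first exact: in_g_sbracket.
  exact: homogeneous_sbracket.
rewrite sbracket_even ad_sub !ad_mul hv Yx subrr.
by rewrite mul0mx mulmx0 add0r addr0 mulmxN mulNmx opprB addrC opprK.
Qed.

(** As a derivation, ad Y multiplies this bracket by -2; but the bracket is an even element of [g],
    hence commutes with Y. *)
Lemma sbracket_gm1_gm1 (hg : admissible g) v v' :
  in_gm1 K g v -> in_gm1 K g v' -> sbracket true true v v' = 0.
Proof.
move=> /in_gm1P [gv v1 hv] /in_gm1P [gv' v1' hv'].
have [_ [_ [_ _]]] := even_decomposition hg
  (in_g_sbracket v1 v1' gv gv') (homogeneous_sbracket v1 v1').
rewrite /sbracket expr1 scaleN1r opprK => /eqP.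
rewrite -subr_eq0 ad_add !ad_mul hv hv' !(mulNmx, mulmxN) -!opprD oppr_eq0.
by rewrite addrACA -mulr2n -scaler_nat scaler_eq0 pnatr_eq0 => /eqP.
Qed.

(** Since ad Y is an involution on odd elements, the components are (x + [Y, x])/2 and (x -
    [Y, x])/2. *)
Lemma odd_decomposition (hg : admissible g) x : in_g K g x -> homogeneous true x ->
  exists u v, [/\ in_g1 K g u, in_gm1 K g v & x = u + v].
Proof.
move=> gx x1; have hx := hypercharge_odd hg x1.
set x' := Y *m x - x *m Y in hx *.
have Y0 := @homogeneous_hypercharge K g; have gY := @in_g_hypercharge K g.
have gx' : in_g K g x'.
  by rewrite /x' -(@sbracket_even _ _ true); apply: in_g_sbracket.
have x1' : homogeneous true x'.
  by rewrite /x' -(@sbracket_even _ _ true); apply: (homogeneous_sbracket Y0 x1).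
exists (2^-1 *: x + 2^-1 *: x'), (2^-1 *: x - 2^-1 *: x'); split.
- apply/in_g1P; split; first exact: in_gD (in_gZ _ _) (in_gZ _ _).
    exact: homogeneousD (homogeneousZ _ _) (homogeneousZ _ _).
  by rewrite ad_add -!scalemxAl -!scalemxAr -!scalerBr -/x' hx addrC.
- apply/in_gm1P; split; first exact: in_gB (in_gZ _ _) (in_gZ _ _).
    exact: homogeneousB (homogeneousZ _ _) (homogeneousZ _ _).
  by rewrite ad_sub -!scalemxAl -!scalemxAr -!scalerBr -/x' hx -scalerN opprB.
rewrite addrACA subrr addr0 -scalerDl -[in LHS](scale1r x); congr (_ *: _).
by rewrite -mulr2n -[_ *+ 2]mulr_natl divff // pnatr_eq0.
Qed.

Lemma in_g_decomposition (hg : admissible g) x : in_g K g x ->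
  exists c s u v, [/\ in_s K g s, in_g1 K g u, in_gm1 K g v &
    x = c *: Y + u + (s + v)].
Proof.
move=> gx; have [c [s [hs e0 _]]] :=
  even_decomposition hg (in_g_part false gx) (homogeneous_part false x).
have [u [v [hu hv e1]]] :=
  odd_decomposition hg (in_g_part true gx) (homogeneous_part true x).
by exists c, s, u, v; split; rewrite // -[LHS]partD e0 e1 addrACA.
Qed.

End OddParts.
Arguments in_g1P {K g u}.
Arguments in_gm1P {K g v}.

(** * Kac matrices as functions of the hypercharge *)

Section Words.
Context {K : numFieldType} {D r : nat}.
Implicit Types A : 'I_r -> 'M[K]_D.

Definition word A (l : seq 'I_r) : 'M[K]_D := \big[mulmx/1%:M]_(k <- l) A k.

Lemma word_cons A k l : word A (k :: l) = A k *m word A l.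
Proof. exact: big_cons. Qed.

Definition elts (S : {set 'I_r}) : seq 'I_r :=
  [seq k <- index_enum 'I_r | k \in S].

Lemma word_elts A (S : {set 'I_r}) : \prod_(k in S) A k = word A (elts S).
Proof. by rewrite -big_filter. Qed.

Lemma size_elts (S : {set 'I_r}) : size (elts S) = #|S|.
Proof. by rewrite size_filter -sum1_count sum1_card. Qed.

(** Multiplication in an exterior algebra: [c] is a sign, or 0 when [l] already occurs. It is chosen
    before [A], so one [c] serves the Kac matrices at all hypercharges. *)
Lemma word_insert l (S : {set 'I_r}) : exists c : K, forall A,
  (forall j k, A j *m A k + A k *m A j = 0) ->
  A l *m word A (elts S) = c *: word A (elts (l |: S)).
Proof.
pose W A (s : seq 'I_r) (T : {set 'I_r}) := word A [seq k <- s | k \in T].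
(* The induction runs over duplicate-free lists containing [l], in place of the full enumeration. *)
suff key s : uniq s -> l \in s -> exists c : K, forall A,
    (forall j k, A j *m A k + A k *m A j = 0) ->
    A l *m W A s S = c *: W A s (l |: S).
  have [c hc] := key _ (index_enum_uniq 'I_r) (mem_index_enum l).
  by exists c.
elim: s => // k s IH /= /andP [ks us]; rewrite inE.
have sq0 A : (forall i j, A i *m A j + A j *m A i = 0) -> A l *m A l = 0.
  move=> /(_ l l) /eqP; rewrite -mulr2n -scaler_nat scaler_eq0 pnatr_eq0.
  by move=> /eqP.
case: (eqVneq l k) => [ek _|nlk /= ls]; last first.
  have [c hc] := IH us ls; rewrite /W /= in_setU1 eq_sym (negPf nlk) /=.
  have [kS|kS] := boolP (k \in S); last by exists c.
  exists (- c) => A hA; rewrite !word_cons mulmxA.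
  have /eqP := hA l k; rewrite addr_eq0 => /eqP ->.
  by rewrite mulNmx -mulmxA [A l *m _]hc // scaleNr -scalemxAr.
rewrite /W /= -ek setU11 in ks *; have [kS|kS] := boolP (l \in S).
  by exists 0 => A hA; rewrite word_cons mulmxA sq0 // mul0mx scale0r.
exists 1 => A _; rewrite scale1r word_cons; congr (_ *m word _ _).
apply: eq_in_filter => j js; rewrite in_setU1.
by case: eqP => // jl; rewrite -jl js in ks.
Qed.

End Words.

Section Affine.
Context {K : numFieldType}.

Definition affine (V : lmodType K) (f : K -> V) : Prop :=
  forall t, f t = f 0 + t *: (f 1 - f 0).

Lemma affine_const (V : lmodType K) (f : K -> V) :
  (forall t, f t = f 0) -> affine f.
Proof. by move=> h t; rewrite (h 1) (h t) subrr scaler0 addr0. Qed.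

Lemma affine_linear (V : lmodType K) c (f f' : K -> V) :
  affine f -> affine f' -> affine (fun t => c *: f t + f' t).
Proof.
move=> hf hf' t; rewrite {1}hf {1}hf' opprD addrACA -scalerBr !scalerDr.
by rewrite !scalerA (mulrC c) addrACA.
Qed.

Lemma affine_comp (V V' : lmodType K) (h : {linear V -> V'}) (f : K -> V) :
  affine f -> affine (fun t => h (f t)).
Proof. by move=> hf t; rewrite hf linearD linearZ /= linearB. Qed.

Lemma eq_affine (V : lmodType K) (f f' : K -> V) :
  f =1 f' -> affine f -> affine f'.
Proof. by move=> e h t; rewrite -!e. Qed.

End Affine.

Section LinearOn.
Context {K : numFieldType} {g : superalgebra}.

Lemma eq_mulmx_cV m n (A B : 'M[K]_(m, n)) :
  (forall w : 'cV_n, A *m w = B *m w) -> A = B.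
Proof.
by move=> h; apply/matrixP => i j; have /colP/(_ i) := h (delta_mx j 0);
   rewrite -!colE !mxE.
Qed.

Context {V : lmodType K} {f : gl K g -> V} (fL : linear_on (in_g K g) f).

Lemma linear_on0 : f 0 = 0.
Proof.
have := fL 1 (in_g0 g) (in_g0 g); rewrite !scale1r addr0 => /eqP.
by rewrite -subr_eq0 opprD addNKr oppr_eq0 => /eqP.
Qed.

Lemma linear_onD x x' : in_g K g x -> in_g K g x' -> f (x + x') = f x + f x'.
Proof. by move=> hx hx'; rewrite -[x]scale1r fL // !scale1r. Qed.

Lemma linear_onZ c x : in_g K g x -> f (c *: x) = c *: f x.
Proof.
by move=> hx; rewrite -[c *: x]addr0 fL ?in_g0 // linear_on0 addr0.
Qed.

Lemma linear_on_sum (I : Type) (s : seq I) (c : I -> K) (x : I -> gl K g) :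
  (forall i, in_g K g (x i)) ->
  f (\sum_(i <- s) c i *: x i) = \sum_(i <- s) c i *: f (x i).
Proof.
move=> hx; elim: s => [|i s IH]; first by rewrite !big_nil linear_on0.
rewrite !big_cons -IH fL //.
by elim/big_rec: _ => [|j z _ hz]; [exact: in_g0|exact: in_g_linear].
Qed.

End LinearOn.

(** * The Kac matrices in the monomial basis *)

Section KacMatrices.
Context {K : numFieldType} {g : superalgebra} {d r D : nat}.
Context (hg : admissible g) {lam : gl K g -> 'M[K]_d} {vs : r.-tuple (gl K g)}.
Context (hvs : is_basis_gm1 vs).
Context {num : 'I_D -> {set 'I_r} * 'I_d} (hnum : bijective num).
Context {rho : K -> gl K g -> 'M[K]_D}.
Context (hrho : forall t, is_kac_matrices lam t vs num (rho t)).

Local Notation Y := (hypercharge g : gl K g).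

(* The matrix of w |-> 1 (x) w. *)
Definition top_mx : 'M[K]_(D, d) := \matrix_(i, j) (num i == (set0, j))%:R.

Local Notation I0 := top_mx.
Local Notation v k := (tnth vs k).

Lemma vs_gm1 k : in_gm1 K g (v k).
Proof. by rewrite -hvs.2; apply/memv_span/mem_tnth. Qed.

Lemma top_mx_delta i j : num i = (set0, j) -> I0 *m delta_mx j 0 = delta_mx i 0 :> 'cV_D.
Proof.
move=> hi; rewrite -colE; apply/colP => k; rewrite !mxE andbT -hi.
by rewrite (inj_eq (bij_inj hnum)).
Qed.

Lemma kac_linear t : linear_on (in_g K g) (rho t).
Proof. by have [iota []] := hrho t. Qed.

Lemma kac_sbracket t b c x x' : in_g K g x -> in_g K g x' ->
  homogeneous b x -> homogeneous c x' ->
  rho t (sbracket b c x x') = sbracket b c (rho t x) (rho t x').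
Proof.
have [iota [_ [[_ _ hM] _ _] _]] := hrho t => gx gx' hx hx'.
apply: eq_mulmx_cV => w; have := hM _ _ _ _ w gx gx' hx hx'.
by rewrite /mxact => ->; rewrite /sbracket mulmxBl -scalemxAl !mulmxA.
Qed.

Lemma kac_top t :
  [/\ forall x, in_s K g x -> rho t x *m I0 = I0 *m lam x,
      rho t Y *m I0 = t *: I0 &
      forall u, in_g1 K g u -> rho t u *m I0 = 0].
Proof.
have [iota [_ [_ [iotaL hs hY h1] _] hnumE]] := hrho t.
have [num' numK num'K] := hnum.
pose iotaLin := GRing.isLinear.Build _ _ _ _ iota iotaL.
pose F : {linear 'cV_d -> 'cV_D} := HB.pack iota iotaLin.
have iotaE w : iota w = I0 *m w.
  have -> : w = \sum_j w j 0 *: delta_mx j 0.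
    by rewrite [LHS]matrix_sum_delta; apply: eq_bigr => j _; rewrite big_ord1.
  rewrite -[iota _]/(F _) linear_sum mulmx_sumr; apply: eq_bigr => j _.
  rewrite linearZ /= -scalemxAr; congr (_ *: _).
  have := hnumE (num' (set0, j)); rewrite num'K /= big_set0 mul1mx => ->.
  by rewrite (@top_mx_delta (num' (set0, j))) ?num'K.
split.
- move=> x hx; apply: eq_mulmx_cV => w.
  by rewrite -!mulmxA -!iotaE hs.
- apply: eq_mulmx_cV => w.
  by rewrite -!mulmxA -!iotaE -[LHS]hY iotaE -scalemxAr -scalemxAl.
- move=> u hu; apply: eq_mulmx_cV => w.
  by rewrite -!mulmxA -!iotaE -[LHS]h1 // iotaE mulmx0 mul0mx.
Qed.

Local Notation W t l := (word (fun k => rho t (v k)) l).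

Lemma kac_basis t i :
  W t (elts (num i).1) *m I0 *m delta_mx (num i).2 0 = delta_mx i 0 :> 'cV_D.
Proof.
have [iota [_ [_ [iotaL hs hY h1] _] hnumE]] := hrho t.
have [num' numK num'K] := hnum.
rewrite -hnumE word_elts -mulmxA; congr (_ *m _).
have := hnumE (num' (set0, (num i).2)); rewrite num'K /= big_set0 mul1mx => ->.
by rewrite (@top_mx_delta (num' (set0, (num i).2))) ?num'K.
Qed.

(** Every basis vector is a word applied to the top component. Arbitrary words, not only ordered
    ones, allow induction on the word. *)
Lemma eq_on_words t (A B : 'M[K]_D) :
  (forall l, A *m W t l *m I0 = B *m W t l *m I0) -> A = B.
Proof.
move=> h; apply/matrixP => i j.
have e : A *m delta_mx j 0 = B *m delta_mx j 0 :> 'cV_D.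
  by rewrite -(kac_basis t) 2!mulmxA h !mulmxA.
by have /colP/(_ i) := e; rewrite -!colE !mxE.
Qed.

Lemma kac_lowering_anticomm t j k :
  rho t (v j) *m rho t (v k) + rho t (v k) *m rho t (v j) = 0.
Proof.
have [gj oj _] := in_gm1P (vs_gm1 j); have [gk ok _] := in_gm1P (vs_gm1 k).
have := kac_sbracket t gj gk oj ok.
rewrite (sbracket_gm1_gm1 hg) ?vs_gm1 // (linear_on0 (kac_linear t)).
by rewrite /sbracket expr1 scaleN1r opprK.
Qed.

(** A lowering generator sends a monomial to a multiple of a monomial, with the coefficient of
    [word_insert], which is free of [t]. *)
Lemma kac_basis_const t k : rho t (v k) = rho 0 (v k).
Proof.
have [num' numK num'K] := hnum.
apply/matrixP => i j.
have e : rho t (v k) *m delta_mx j 0 = rho 0 (v k) *m delta_mx j 0 :> 'cV_D.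
  have [c hc] := @word_insert K D _ k (num j).1.
  suff h s : rho s (v k) *m delta_mx j 0 =
      c *: delta_mx (num' (k |: (num j).1, (num j).2)) 0 :> 'cV_D by rewrite !h.
  rewrite -(kac_basis s j) 2!mulmxA (hc (fun k => rho s (v k))); last first.
    by move=> *; apply: kac_lowering_anticomm.
  by rewrite -!scalemxAl -(kac_basis s (num' _)) num'K.
by have /colP/(_ i) := e; rewrite -!colE !mxE.
Qed.

Lemma kac_gm1_const t x : in_gm1 K g x -> rho t x = rho 0 x.
Proof.
rewrite -hvs.2 => /coord_span ->.
have gv (i : 'I_r) : in_g K g vs`_i.
  by rewrite -tnth_nth; case/in_gm1P: (vs_gm1 i).
rewrite !(linear_on_sum (kac_linear _)) //; apply: eq_bigr => i _.
by rewrite -tnth_nth kac_basis_const.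
Qed.

(** Pass [x] through a word by x v = [x, v] + v x, where [x, v] stays in g_(-1); on the top
    component [x] acts through [lam]. *)
Lemma kac_s_const t x : in_s K g x -> rho t x = rho 0 x.
Proof.
move=> hx; apply: (@eq_on_words 0) => l.
elim: l x hx => [|k l IH] x hx.
  have h1 s : rho s x *m I0 = I0 *m lam x by have [] := kac_top s => h _ _; apply: h.
  by rewrite /word big_nil !mulmx1 !h1.
have [gv v1 _] := in_gm1P (vs_gm1 k).
have h s : rho s x *m (rho 0 (v k)) =
    rho s (sbracket false true x (v k)) + rho 0 (v k) *m rho s x.
  rewrite kac_sbracket ?(in_s_in_g hx) ?(in_s_even hx) // sbracket_even.
  by rewrite !(kac_basis_const s) subrK.
rewrite word_cons !mulmxA !h !mulmxDl -!mulmxA.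
by rewrite (kac_gm1_const t (sbracket_s_gm1 hg hx (vs_gm1 k))) !(mulmxA (rho _ x)) IH.
Qed.

Lemma kac_hypercharge_word t l :
  rho t Y *m W 0 l *m I0 = (t - (size l)%:R) *: (W 0 l *m I0).
Proof.
elim: l => [|k l IH].
  by rewrite /word big_nil mulmx1 mul1mx subr0; have [_ ->] := kac_top t.
have [gv v1 hv] := in_gm1P (vs_gm1 k).
have gY := @in_g_hypercharge K g.
have := kac_sbracket t gY gv (@homogeneous_hypercharge K g) v1.
rewrite !sbracket_even hv -scaleN1r (linear_onZ (kac_linear t)) //.
move/eqP; rewrite eq_sym subr_eq !(kac_basis_const t) => /eqP h.
rewrite word_cons !mulmxA h !mulmxDl -!mulmxA (mulmxA (rho t Y)) IH.
rewrite -scalemxAl -scalemxAr -scalerDl; congr (_ *: _).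
by rewrite addrC -natr1 opprD addrA.
Qed.

(** Each lowering generator lowers the top eigenvalue [t] by 1. These weights later determine
    parities and the eigenspace of R_N(Y). *)
Lemma kac_hypercharge t :
  rho t Y = diag_mx (\row_i (t - #|(num i).1|%:R)).
Proof.
apply/matrixP => i j.
have /colP/(_ i) : rho t Y *m delta_mx j 0 =
    (t - #|(num j).1|%:R) *: delta_mx j 0 :> 'cV_D.
  rewrite -(kac_basis 0 j) 2!mulmxA kac_hypercharge_word size_elts.
  by rewrite -!scalemxAl.
rewrite -colE !mxE andbT => ->.
by case: eqP => [->|_]; rewrite ?mulr1 // mulr0.
Qed.

Lemma affine_even x : in_g K g x -> homogeneous false x -> affine (rho^~ x).
Proof.
move=> gx x0; have [c [s [hs -> _]]] := even_decomposition hg gx x0.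
have gY := @in_g_hypercharge K g.
apply: (@eq_affine _ _ (fun t => c *: rho t Y + rho t s)) => [t|].
  by rewrite kac_linear // in_s_in_g.
apply: affine_linear; last by apply: affine_const => t; apply: kac_s_const.
move=> t; rewrite !kac_hypercharge; apply/matrixP => i j; rewrite !mxE.
case: eqP => _; last by rewrite !mulr0n subr0 mulr0 addr0.
by rewrite !mulr1n opprB addrA addrNK sub0r subr0 mulr1 addrC.
Qed.

(** Use u v = {u, v} - v u along a word: {u, v} is even, hence affine, and is applied to a vector
    free of [t], so the degree does not grow. On the top component [u] is zero. *)
Lemma affine_g1 u : in_g1 K g u -> affine (rho^~ u).
Proof.
move=> hu t; apply: (@eq_on_words 0) => l; move: t.
suff key : affine (fun t => rho t u *m W 0 l *m I0).
  by move=> t; rewrite key !mulmxDl -!scalemxAl !mulmxBl.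
elim: l => [|k l IH].
  apply: affine_const => t.
  have h1 s : rho s u *m I0 = 0 by have [_ _] := kac_top s; apply.
  by rewrite /word big_nil !mulmx1 !h1.
have [gv v1 _] := in_gm1P (vs_gm1 k); have [gu u1 _] := in_g1P hu.
pose z := sbracket true true u (v k).
apply: (@eq_affine _ _ (fun t =>
  (-1) *: (rho 0 (v k) *m (rho t u *m W 0 l *m I0)) + rho t z *m (W 0 l *m I0))).
  move=> t; rewrite /z /= kac_sbracket // /sbracket expr1 !scaleN1r opprK.
  rewrite (kac_basis_const t) mulmxDl word_cons !mulmxA.
  by rewrite addrCA addNr addr0.
apply: affine_linear; first exact: (affine_comp (mulmx (rho 0 (v k)))).
apply: (affine_comp (mulmxr (W 0 l *m I0))); apply: affine_even.
  exact: in_g_sbracket.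
exact: (homogeneous_sbracket u1 v1).
Qed.

Lemma kac_affine x : in_g K g x -> affine (rho^~ x).
Proof.
move=> gx; have [c [s [u [w [hs hu hw ->]]]]] := in_g_decomposition hg gx.
have gY := @in_g_hypercharge K g; have gs := in_s_in_g hs.
have [gu _ _] := in_g1P hu; have [gw _ _] := in_gm1P hw.
apply: (@eq_affine _ _ (fun t =>
  c *: rho t Y + (1 *: rho t u + (1 *: rho t s + rho t w)))).
  move=> t; rewrite !scale1r -addrA kac_linear ?in_gD //.
  by rewrite !(linear_onD (kac_linear t)) ?in_gD.
apply: affine_linear.
  by apply: affine_even => //; exact: homogeneous_hypercharge.
apply: affine_linear; first exact: affine_g1.
apply: affine_linear; apply: affine_const => t; first exact: kac_s_const.
exact: kac_gm1_const.
Qed.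

End KacMatrices.

Section DerivativeOfAffine.
Import numFieldNormedType.Exports.

Lemma derive1_affine (K : numFieldType) (f : K -> K) (y : K) :
  affine (f : K -> K^o) -> derive1 (f : K^o -> K^o) y = f 1 - f 0.
Proof.
move=> hf; rewrite [X in derive1 X](_ : _ =
  cst (f 0) + (f 1 - f 0) \*: (id : K^o -> K^o)); last first.
  by apply/funext => t; rewrite hf; congr (_ + _); exact: mulrC.
by rewrite derive1E derive_val add0r /GRing.scale /= mulr1.
Qed.

End DerivativeOfAffine.

(** * The derivative in the hypercharge *)

Section KacDerivative.
Context {K : numFieldType} {g : superalgebra} {d r D : nat}.
Context (hg : admissible g) {lam : gl K g -> 'M[K]_d} {vs : r.-tuple (gl K g)}.
Context (hvs : is_basis_gm1 vs).
Context {num : 'I_D -> {set 'I_r} * 'I_d} (hnum : bijective num).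
Context {rho : K -> gl K g -> 'M[K]_D}.
Context (hrho : forall t, is_kac_matrices lam t vs num (rho t)).

Local Notation Y := (hypercharge g : gl K g).

(** By affinity this is the derivative at every point. Taken for all of [g], it gives one block
    formula for s, g_(-1), Y and g_1 together. *)
Definition slope (x : gl K g) : 'M[K]_D := rho 1 x - rho 0 x.

Lemma kac_add y s x : in_g K g x -> rho (y + s) x = rho y x + s *: slope x.
Proof.
move=> gx; have h := kac_affine hg hvs hnum hrho gx.
by rewrite h [rho y x]h -addrA -scalerDl.
Qed.

Lemma rho_deriv_slope y x : in_g K g x -> rho_deriv rho y x = slope x.
Proof.
move=> gx; apply/matrixP => i j; rewrite !mxE derive1_affine // => t.
have /matrixP/(_ i j) := kac_affine hg hvs hnum hrho gx t.
by rewrite !mxE.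
Qed.

Lemma slope_linear : linear_on (in_g K g) slope.
Proof.
move=> c x x' gx gx'; rewrite /slope !(kac_linear hrho) // opprD addrACA.
by rewrite -scalerBr.
Qed.

Lemma slope_s_gm1 x v : in_s K g x -> in_gm1 K g v -> slope (x + v) = 0.
Proof.
move=> hx hv; have gx := in_s_in_g hx; have [gv _ _] := in_gm1P hv.
rewrite /slope !(linear_onD (kac_linear hrho _)) //.
rewrite (kac_s_const hg hvs hnum hrho 1 hx).
by rewrite (kac_gm1_const hg hvs hnum hrho 1 hv) subrr.
Qed.

Lemma slope_hypercharge : slope Y = 1%:M.
Proof.
rewrite /slope !(kac_hypercharge hg hvs hnum hrho).
apply/matrixP => i j; rewrite !mxE.
case: eqP => _; last by rewrite !mulr0n subr0.
by rewrite !mulr1n opprB addrA addrNK subr0.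
Qed.

(* Comparing coefficients of [s] in the identity                               *)
(* [rho (y + s) [x, x'] = [rho (y + s) x, rho (y + s) x']].                     *)
Lemma slope_sbracket y b c x x' : in_g K g x -> in_g K g x' ->
    homogeneous b x -> homogeneous c x' ->
  slope (sbracket b c x x') =
    sbracket b c (rho y x) (slope x') + sbracket b c (slope x) (rho y x') /\
  sbracket b c (slope x) (slope x') = 0.
Proof.
move=> gx gx' hx hx'; have gz := in_g_sbracket hx hx' gx gx'.
set z := sbracket b c x x' in gz *.
set R := rho y x; set Q := rho y x'; set R' := slope x; set Q' := slope x'.
set T := sbracket b c R Q' + sbracket b c R' Q.
have h s : s *: slope z = s *: T + (s * s) *: sbracket b c R' Q'.
  rewrite {}/T.
  have e0 := kac_sbracket hrho y gx gx' hx hx'.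
  have := kac_sbracket hrho (y + s) gx gx' hx hx'.
  rewrite !(kac_add y s) // e0 => /(canRL (addKr _)) ->.
  rewrite /sbracket -/R -/Q -/R' -/Q'.
  clearbody R Q R' Q'; rewrite !mulmxDl !mulmxDr.
  rewrite -!scalemxAl -!scalemxAr.
  move: ((-1) ^+ _) => e.
  move: (R *m Q) (R *m Q') (R' *m Q) (R' *m Q') (Q *m R) (Q' *m R) (Q *m R') (Q' *m R').
  move=> m1 m2 m3 m4 m5 m6 m7 m8; apply/matrixP => i j; rewrite !mxE; ring.
(* The values [s = 1] and [s = -1] give [T] plus and minus the quadratic term, which therefore
   vanishes in characteristic 0. *)
have h1 : slope z = T + sbracket b c R' Q' by have := h 1; rewrite mulr1 !scale1r.
have hm1 : slope z = T - sbracket b c R' Q'.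
  apply: oppr_inj; have := h (-1); rewrite mulrNN mulr1 !scaleN1r scale1r => ->.
  by rewrite opprB addrC.
have q0 : sbracket b c R' Q' = 0.
  apply/eqP; move/eqP: h1; rewrite hm1 (inj_eq (addrI _)) eq_sym -addr_eq0.
  by rewrite -mulr2n -scaler_nat scaler_eq0 pnatr_eq0.
by split; rewrite // h1 q0 addr0.
Qed.

(* Parity is read off the eigenvalues t - |S| of the hypercharge: even elements *)
(* commute with it, odd ones satisfy [Y, [Y, x]] = x.                           *)
Lemma kac_parity_rho t : respects_parity (in_g K g) (kac_parity num) (rho t).
Proof.
move=> b x gx hx i j; pose n k : K := #|(num k).1|%:R.
have gY := @in_g_hypercharge K g; have Y0 := @homogeneous_hypercharge K g.
have adY (X : 'M[K]_D) : (rho t Y *m X - X *m rho t Y) i j = (n j - n i) * X i j.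
  rewrite (kac_hypercharge hg hvs hnum hrho) mul_diag_mx mul_mx_diag !mxE.
  rewrite /n; ring.
case: b hx => hx.
  have gx' := in_g_sbracket Y0 hx gY gx.
  have hx' := homogeneous_sbracket Y0 hx.
  have := kac_sbracket hrho t gY gx' Y0 hx'.
  rewrite (kac_sbracket hrho t gY gx Y0 hx) !sbracket_even hypercharge_odd //.
  move=> /matrixP/(_ i j); rewrite !adY mulrA => /eqP e xn0.
  rewrite -[X in X == _]mul1r (inj_eq (mulIf xn0)) eq_sym -expr2 sqrf_eq1 in e.
  rewrite /kac_parity; case/orP: e; rewrite subr_eq /n.
    by rewrite nat1r eqr_nat => /eqP ->; rewrite /= negbK.
  by rewrite eq_sym addrC subr_eq natr1 eqr_nat => /eqP ->.
have [c [s [_ _ Yx]]] := even_decomposition hg gx hx.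
have := kac_sbracket hrho t gY gx Y0 hx.
rewrite !sbracket_even Yx subrr (linear_on0 (kac_linear hrho t)).
move=> /matrixP/(_ i j); rewrite adY mxE => /esym/eqP e xn0.
rewrite mulf_eq0 (negPf xn0) orbF subr_eq0 /n eqr_nat in e.
by rewrite /kac_parity (eqP e).
Qed.

End KacDerivative.
Arguments slope {K g D} rho x.

(** * Block vectors *)

Section BlockVectors.
Context {K : fieldType} {D : nat}.

(** Indexing by [nat] with value 0 from [N] on spares the last row a separate case in
    [blk_upper_block]. *)
Definition blk N (n : nat) (w : 'cV[K]_(block_dim N D)) : 'cV[K]_D :=
  if insub n is Some k then submxcol w (k : 'I_N) else 0.

Definition of_blk N (F : nat -> 'cV[K]_D) : 'cV[K]_(block_dim N D) :=
  \mxcol_(k < N) F k.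

Lemma blk_ge N (w : 'cV[K]_(block_dim N D)) n : (N <= n)%N -> blk n w = 0.
Proof. by move=> h; rewrite /blk insubF // ltnNge h. Qed.

Lemma blk_ord N (w : 'cV[K]_(block_dim N D)) (k : 'I_N) :
  blk k w = submxcol w k.
Proof. by rewrite /blk valK. Qed.

Lemma blkE N (w : 'cV[K]_(block_dim N D)) s :
  w s 0 = blk (tagnat.sig1 s) w (tagnat.sig2 s) 0.
Proof. by rewrite blk_ord mxE tagnat.sig2K. Qed.

Lemma blk_inj N (w w' : 'cV[K]_(block_dim N D)) :
  (forall n, blk n w = blk n w') -> w = w'.
Proof. by move=> h; apply/colP => s; rewrite !blkE h. Qed.

Lemma blk_is_linear N n : linear (@blk N n).
Proof.
move=> a w w'; rewrite /blk; case: insubP => [k _ _|_].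
  by apply/colP => i; rewrite !mxE.
by rewrite scaler0 addr0.
Qed.
HB.instance Definition _ N n :=
  GRing.isLinear.Build K 'cV[K]_(block_dim N D) 'cV[K]_D _ (@blk N n)
    (@blk_is_linear N n).

Lemma blk_of_blk N F n : blk n (of_blk N F) = if (n < N)%N then F n else 0.
Proof.
rewrite /blk; case: insubP => [k hk <-|/negPf ->] //.
by rewrite /of_blk mxcolK ltn_ord.
Qed.

Lemma blk_upper_block N (A B : 'M[K]_D) (w : 'cV[K]_(block_dim N D)) n :
  blk n (upper_block N A B *m w) = A *m blk n w + B *m blk n.+1 w.
Proof.
have [hn|hn] := ltnP n N; last first.
  by rewrite !blk_ge // ?(leqW hn) // !mulmx0 addr0.
rewrite (_ : n = Ordinal hn :> nat) // blk_ord -[in LHS](submxcolK w).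
rewrite mul_mxblock_mxrow mxcolK (bigD1 (Ordinal hn)) //= eqxx -blk_ord.
congr (_ + _); have [hn1|hn1] := ltnP n.+1 N; last first.
  rewrite [blk n.+1 w]blk_ge // mulmx0 big1 // => l lk.
  rewrite eq_sym (negPf lk).
  by rewrite gtn_eqF ?mul0mx // (leq_trans (ltn_ord l)).
rewrite (bigD1 (Ordinal hn1)) /=; last by rewrite -val_eqE /= gtn_eqF.
rewrite -val_eqE /= ltn_eqF // eqxx big1 ?addr0 => [|l /andP [lk ln]].
  by rewrite -(blk_ord w (Ordinal hn1)).
rewrite -(val_eqE l (Ordinal hn1)) /= eq_sym in ln.
by rewrite eq_sym (negPf lk) (negPf ln) mul0mx.
Qed.

Lemma upper_block_linear N c (A B A' B' : 'M[K]_D) :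
  upper_block N (c *: A + A') (c *: B + B') =
  c *: upper_block N A B + upper_block N A' B'.
Proof.
apply/matrixP => i j; rewrite !mxE.
by case: eqP => _; last case: eqP => _; rewrite !mxE ?mulr0 ?addr0.
Qed.

Lemma blk_incl k N (w : 'cV[K]_(block_dim k D)) n :
  blk n (block_incl K D k N w) = if (n < N)%N then blk n w else 0.
Proof. by rewrite -[block_incl _ _ _ _ _]/(of_blk N (fun m => blk m w)) blk_of_blk. Qed.

(** Replaces the span by vanishing conditions on blocks, the form used for the filtration. *)
Lemma mem_first_blocks N k (w : 'cV[K]_(block_dim N D)) :
  reflect (forall n, (k <= n)%N -> blk n w = 0) (w \in first_blocks K D N k).
Proof.
apply: (iffP idP) => [wW n kn|h].
  suff /subvP/(_ _ wW) : (first_blocks K D N k <= lker (linfun (@blk N n)))%VS.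
    by rewrite memv_ker lfunE => /eqP.
  apply/span_subvP => _ /mapP [s + ->]; rewrite mem_filter => /andP [sk _].
  rewrite memv_ker lfunE /=; apply/eqP.
  have [hn|hn] := ltnP n N; last by rewrite blk_ge.
  rewrite (_ : n = Ordinal hn :> nat) // blk_ord; apply/colP => j.
  rewrite !mxE; case: eqP => //= es; move: sk.
  by rewrite -es tagnat.Rank1K /= ltnNge kn.
have -> : w = \sum_s w s 0 *: delta_mx s 0.
  by rewrite [LHS]matrix_sum_delta; apply: eq_bigr => s _; rewrite big_ord1.
apply: memv_suml => s _; have [ks|sk] := leqP k (tagnat.sig1 s).
  by rewrite blkE h // mxE scale0r mem0v.
apply/memvZ/memv_span/mapP; exists s => //.
by rewrite mem_filter sk mem_enum.
Qed.

End BlockVectors.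

Section SingleBlock.
Context {K : fieldType} {D : nat}.

Definition in_blk N k (z : 'cV[K]_D) : 'cV[K]_(block_dim N D) :=
  of_blk N (fun n => if n == k then z else 0).

Lemma blk_in_blk N k z n : (k < N)%N ->
  blk n (in_blk N k z) = if n == k then z else 0.
Proof.
move=> kN; rewrite blk_of_blk; case: (n =P k) => [->|_]; first by rewrite kN.
by rewrite if_same.
Qed.

Lemma in_blk_is_linear N k : linear (@in_blk N k).
Proof.
move=> c z z'; apply: blk_inj => n; rewrite linearD linearZ_LR /= !blk_of_blk.
by case: (n < N)%N; case: (n == k); rewrite ?scaler0 ?addr0.
Qed.
HB.instance Definition _ N k :=
  GRing.isLinear.Build K 'cV[K]_D 'cV[K]_(block_dim N D) _ (@in_blk N k)
    (@in_blk_is_linear N k).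

Lemma in_blk_sum N (w : 'cV[K]_(block_dim N D)) :
  w = \sum_(k < N) in_blk N k (blk k w).
Proof.
apply: blk_inj => n; rewrite linear_sum /=.
have [nN|nN] := ltnP n N; last first.
  by rewrite blk_ge // big1 // => k _; rewrite blk_ge.
rewrite (bigD1 (Ordinal nN)) //= blk_in_blk // eqxx big1 ?addr0 // => k kn.
by rewrite -val_eqE /= eq_sym in kn; rewrite blk_in_blk // (negPf kn).
Qed.

End SingleBlock.

(** * The block matrices form a graded representation *)

Section Extension.
Context {K : numFieldType} {g : superalgebra} {d r D : nat}.
Context (hg : admissible g) {lam : gl K g -> 'M[K]_d} {vs : r.-tuple (gl K g)}.
Context (hvs : is_basis_gm1 vs).
Context {num : 'I_D -> {set 'I_r} * 'I_d} (hnum : bijective num).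
Context {rho : K -> gl K g -> 'M[K]_D} {y : K}.
Context (hrho : forall t, is_kac_matrices lam t vs num (rho t)).

Local Notation Y := (hypercharge g : gl K g).
Local Notation I0 := (@top_mx K d r D num).

Lemma extension_upper_block N :
  is_extension rho y (fun x => upper_block N (rho y x) (slope rho x)).
Proof.
split.
- move=> c x x' gx gx'; rewrite (kac_linear hrho) // (slope_linear hrho) //.
  exact: upper_block_linear.
- by move=> x v hx hv; rewrite (slope_s_gm1 hg hvs hnum hrho).
- by rewrite (slope_hypercharge hg hvs hnum hrho).
- by move=> u /in_g1P [gu _ _]; rewrite (rho_deriv_slope hg hvs hnum hrho).
Qed.

Context {N : nat} {RN : gl K g -> 'M[K]_(block_dim N D)}.
Context (hRN : is_extension rho y RN).

Lemma extensionE x : in_g K g x -> RN x = upper_block N (rho y x) (slope rho x).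
Proof.
move=> gx; have [c [s [u [v [hs hu hv ->]]]]] := in_g_decomposition hg gx.
have gY := @in_g_hypercharge K g; have gs := in_s_in_g hs.
have [gu _ _] := in_g1P hu; have [gv _ _] := in_gm1P hv.
(* The value on a decomposed element depends only on the defining conditions, so [RN] and the
   explicit candidate agree. *)
have step (S : gl K g -> 'M[K]_(block_dim N D)) : is_extension rho y S ->
    S (c *: Y + u + (s + v)) =
    c *: upper_block N (rho y Y) 1%:M + upper_block N (rho y u) (rho_deriv rho y u)
      + upper_block N (rho y (s + v)) 0.
  case=> SL <- // <- <- //; rewrite -!addrA SL ?in_gD //.
  by rewrite (linear_onD SL gu) ?in_gD.
by rewrite (step _ hRN) -(step _ (extension_upper_block N)).
Qed.

Lemma blk_extension x w n : in_g K g x ->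
  blk n (RN x *m w) = rho y x *m blk n w + slope rho x *m blk n.+1 w.
Proof. by move=> gx; rewrite extensionE // blk_upper_block. Qed.

Lemma extension_rep : is_rep (in_g K g) RN.
Proof.
have [RL _ _ _] := hRN; split=> //; split.
- by move=> x _ c w w'; rewrite /mxact linearP.
- by move=> w c x x' gx gx'; rewrite /mxact RL // mulmxDl scalemxAl.
move=> b c x x' w gx gx' hx hx'; rewrite /mxact; apply: blk_inj => n.
have gz := in_g_sbracket hx hx' gx gx'.
have [e1 e2] := slope_sbracket hg hvs hnum hrho y gx gx' hx hx'.
rewrite linearB linearZ_LR /= !blk_extension // (kac_sbracket hrho) // e1.
(* The contribution of block [n.+2] is the second-order term, where the bracket of the slopes
   vanishes. *)
have e3 : slope rho x *m (slope rho x' *m blk n.+2 w) =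
    (-1) ^+ (b && c) *: (slope rho x' *m (slope rho x *m blk n.+2 w)).
  apply/eqP; rewrite -subr_eq0 !mulmxA scalemxAl -mulmxBl.
  by rewrite -[X in X *m _]/(sbracket b c _ _) e2 mul0mx.
clear e1 e2; move: (slope rho x) (slope rho x') (rho y x) (rho y x') e3.
move=> R' Q' R Q e3.
rewrite /sbracket !mulmxDr e3 !mulmxDl !mulNmx -!scalemxAl !mulmxA.
move: (R *m Q *m _) (Q *m R *m _) (R *m Q' *m _) (Q' *m R *m _)
  (Q *m R' *m _) (R' *m Q *m _) (Q' *m R' *m _) ((-1) ^+ _).
move=> m1 m2 m3 m4 m5 m6 m7 e; apply/matrixP => i j; rewrite !mxE; ring.
Qed.

Lemma extension_parity :
  respects_parity (in_g K g) (block_parity (kac_parity num)) RN.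
Proof.
move=> b x gx hx i j; rewrite extensionE // mxE /block_parity.
have hp t k l : rho t x k l != 0 -> kac_parity num k = b (+) kac_parity num l.
  by apply: (kac_parity_rho hg hvs hnum hrho).
case: ifP => _; first exact: hp.
case: ifP => _; last by rewrite mxE eqxx.
rewrite !mxE => nz; have [e|] := eqVneq (rho 1 x (tagnat.sig2 i) (tagnat.sig2 j)) 0.
  by apply: (hp 0); apply: contraNneq nz => e0; rewrite e e0 subrr.
exact: (hp 1).
Qed.

End Extension.

(** * Indecomposability *)

Section Indecomposable.
Context {K : numFieldType} {g : superalgebra} {d r D : nat}.
Context (hg : admissible g) {lam : gl K g -> 'M[K]_d} {vs : r.-tuple (gl K g)}.
Context (hvs : is_basis_gm1 vs).
Context {num : 'I_D -> {set 'I_r} * 'I_d} (hnum : bijective num).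
Context {rho : K -> gl K g -> 'M[K]_D} {y : K}.
Context (hrho : forall t, is_kac_matrices lam t vs num (rho t)).
Context {N : nat} {RN : gl K g -> 'M[K]_(block_dim N D)}.
Context (N0 : (0 < N)%N) (hRN : is_extension rho y RN).

Local Notation Y := (hypercharge g : gl K g).
Local Notation I0 := (@top_mx K d r D num).

(* [top 0] identifies L(a) with the eigenspace of R_N(Y) for the eigenvalue y; *)
(* [top k] does so modulo the first k blocks.                                  *)
Definition top k (c : 'cV[K]_d) : 'cV[K]_(block_dim N D) := in_blk N k (I0 *m c).

Lemma top_is_linear k : linear (top k).
Proof. by move=> e c c'; rewrite /top mulmxDr -scalemxAr linearP. Qed.
HB.instance Definition _ k := GRing.isLinear.Build K 'cV[K]_d
  'cV[K]_(block_dim N D) _ (top k) (top_is_linear k).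

(** On top components [rho y Y] is the scalar [y], which leaves only the superdiagonal identity
    blocks. *)
Lemma extension_hypercharge_top k c : (k < N)%N ->
  RN Y *m top k c - y *: top k c = if k is k'.+1 then top k' c else 0.
Proof.
move=> kN; apply: blk_inj => n; have gY := @in_g_hypercharge K g.
rewrite linearB linearZ_LR /= (blk_extension hg hvs hnum hrho hRN) //.
rewrite (slope_hypercharge hg hvs hnum hrho) mul1mx !blk_in_blk //.
have [_ hY _] := kac_top hnum hrho y.
have -> : rho y Y *m (if n == k then I0 *m c else 0) =
    y *: (if n == k then I0 *m c else 0).
  by case: ifP => _; rewrite ?mulmx0 ?scaler0 // mulmxA hY scalemxAl.
rewrite addrAC subrr add0r; case: k kN => [|k] kN; first by rewrite linear0.
by rewrite blk_in_blk ?(ltnW kN).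
Qed.

(** In coordinate (S, j) the equation says that block [n.+1] is |S| times block [n]. For S empty
    only block 0 survives; otherwise the vanishing beyond block [N] propagates back to all
    blocks. *)
Lemma extension_hypercharge_eigen w : RN Y *m w = y *: w -> exists c, w = top 0 c.
Proof.
move=> hw; have gY := @in_g_hypercharge K g.
have e n i : blk n.+1 w i 0 = #|(num i).1|%:R * blk n w i 0.
  have /colP/(_ i) := congr1 (blk n) hw.
  rewrite (blk_extension hg hvs hnum hrho hRN) // linearZ_LR /=.
  rewrite (kac_hypercharge hg hvs hnum hrho) (slope_hypercharge hg hvs hnum hrho).
  rewrite mul1mx mul_diag_mx !mxE mulrBl => /eqP.
  by rewrite -[eqbRHS]addr0 -addrA (inj_eq (addrI _)) addrC subr_eq0 => /eqP.
have [num' numK num'K] := hnum.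
exists (\col_j blk 0 w (num' (set0, j)) 0); apply: blk_inj => n.
rewrite blk_in_blk //; apply/colP => i; have [Si|Si] := eqVneq (num i).1 set0.
  case: n => [|n] /=; last by rewrite e Si cards0 mul0r mxE.
  rewrite !mxE (bigD1 (num i).2) //= !mxE -Si -surjective_pairing eqxx mul1r.
  rewrite numK big1 ?addr0 // => j ji; rewrite !mxE.
  case: eqP => [ej|_]; last by rewrite mul0r.
  by rewrite ej eqxx in ji.
have -> : blk n w i 0 = 0.
  have [m le_nm] : exists m, (N <= n + m)%N by exists N; exact: leq_addl.
  elim: m n le_nm => [|m IH] n; first by rewrite addn0 => Nn; rewrite blk_ge // mxE.
  rewrite addnS -addSn => /IH; rewrite e => /eqP.
  by rewrite mulf_eq0 pnatr_eq0 cards_eq0 (negPf Si) => /eqP.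
case: eqP => _; last by rewrite mxE.
rewrite !mxE big1 // => j _; rewrite !mxE.
case: eqP => [ej|_]; last by rewrite mul0r.
by rewrite ej eqxx in Si.
Qed.

Lemma top_inj c : top 0 c = 0 -> c = 0.
Proof.
have [num' numK num'K] := hnum.
move=> /(congr1 (blk 0)); rewrite blk_in_blk // linear0 => h.
apply/colP => j; have /colP/(_ (num' (set0, j))) := h.
rewrite !mxE (bigD1 j) //= !mxE num'K eqxx mul1r big1 ?addr0 // => k kj.
by rewrite !mxE num'K xpair_eqE eqxx /= eq_sym (negPf kj) mul0r.
Qed.

Lemma extension_s_top x c : in_s K g x -> RN x *m top 0 c = top 0 (lam x *m c).
Proof.
move=> hx; have gx := in_s_in_g hx; apply: blk_inj => n.
rewrite (blk_extension hg hvs hnum hrho hRN) // !blk_in_blk //.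
rewrite /slope (kac_s_const hg hvs hnum hrho 1 hx) subrr mul0mx addr0.
case: ifP => _; last by rewrite mulmx0.
by have [hs _ _] := kac_top hnum hrho y; rewrite !mulmxA hs.
Qed.

(** The slope vanishes on g_(-1), so lowering monomials act within each block and build it from its
    top component. *)
Lemma top_generates (V : {vspace 'cV[K]_(block_dim N D)}) :
  submodule (in_g K g) RN V -> (forall k c, (k < N)%N -> top k c \in V) ->
  V = fullv.
Proof.
move=> hV hT; apply/eqP; rewrite eqEsubv subvf; apply/subvP => w _.
rewrite (in_blk_sum w); apply: memv_suml => k _; move: (blk k w) => {w} w.
have -> : w = \sum_i w i 0 *: delta_mx i 0.
  by rewrite [LHS]matrix_sum_delta; apply: eq_bigr => i _; rewrite big_ord1.
rewrite linear_sum; apply: memv_suml => i _; rewrite linearZ; apply: memvZ.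
rewrite -(kac_basis hnum hrho y).
elim: (elts _) => [|j l IH]; first by rewrite /word big_nil mul1mx hT.
have [gv _ _] := in_gm1P (vs_gm1 hvs j).
rewrite word_cons -!mulmxA.
rewrite -mulmxA in IH; set z := word _ l *m _ in IH *.
rewrite /= in IH *; suff -> : in_blk N k (rho y (tnth vs j) *m z) =
    RN (tnth vs j) *m in_blk N k z.
  by apply: hV.
apply: blk_inj => n; rewrite (blk_extension hg hvs hnum hrho hRN) // !blk_in_blk //.
rewrite /slope (kac_gm1_const hg hvs hnum hrho 1 (vs_gm1 hvs j)) subrr mul0mx addr0.
by case: ifP => _; rewrite ?mulmx0.
Qed.

(** Y - y is injective on [U], so climbing the Jordan chain keeps all top components in [V], and
    these generate. *)
Lemma extension_summand (U V : {vspace 'cV[K]_(block_dim N D)}) :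
  submodule (in_g K g) RN U -> submodule (in_g K g) RN V ->
  (U + V)%VS = fullv -> (U :&: V)%VS = 0%VS ->
  (forall c, top 0 c \in U -> c = 0) -> (forall c, top 0 c \in V) -> U = 0%VS.
Proof.
move=> hU hV UV UV0 topU topV; have gY := @in_g_hypercharge K g.
suff V1 : V = fullv by rewrite V1 capvf in UV0.
apply: top_generates => // k; elim: k => [|k IH] c kN; first exact: topV.
have : top k.+1 c \in (U + V)%VS by rewrite UV memvf.
case/memv_addP => u uU [v vV e]; rewrite e.
have := extension_hypercharge_top c kN.
rewrite e mulmxDr scalerDr opprD addrACA => h.
(* (Y - y)u lies in [U], and also in [V], being [top k c] minus (Y - y)v. *)
have hu : RN Y *m u - y *: u = 0.
  apply/eqP; rewrite -memv0 -UV0 memv_cap.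
  rewrite memvB ?memvZ ?hU //= -[X in X \in V](addrK (RN Y *m v - y *: v)) h.
  by rewrite memvB ?IH ?(ltnW kN) // memvB ?memvZ ?hV.
have [c' ec'] := extension_hypercharge_eigen (subr0_eq hu).
by rewrite ec' (topU c') ?linear0 ?add0r // -ec'.
Qed.

Lemma extension_indecomposable (a : simple_root g -> nat) :
  is_irreducible_hw a lam -> indecomposable (in_g K g) RN.
Proof.
case=> _ [d0 irr] _.
have [num' numK num'K] := hnum.
have D0 : (0 < D)%N by apply: leq_ltn_trans (ltn_ord (num' (set0, Ordinal d0))).
split; first by rewrite sum_nat_const card_ord muln_gt0 N0.
move=> U V hU hV UV UV0; have gY := @in_g_hypercharge K g.
pose T : 'Hom('cV[K]_d, 'cV[K]_(block_dim N D)) := linfun (top 0).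
(* The preimage of [Z] under [top 0] is an s-submodule of the irreducible L(a). *)
have preim (Z : {vspace 'cV[K]_(block_dim N D)}) : submodule (in_g K g) RN Z ->
    (forall c, top 0 c \in Z -> c = 0) \/ (forall c, top 0 c \in Z).
  move=> hZ; have memT c : (c \in T @^-1: Z)%VS = (top 0 c \in Z).
    by rewrite -memv_preim lfunE.
  case: (irr (T @^-1: Z)%VS) => [x c hx|e|e].
  - by rewrite !memT -extension_s_top //; apply: hZ; exact: in_s_in_g.
  - by left=> c; rewrite -memT e memv0 => /eqP.
  - by right=> c; rewrite -memT e memvf.
pose c0 : 'cV[K]_d := delta_mx (Ordinal d0) 0.
have c0n : c0 != 0.
  by apply/eqP => /colP/(_ (Ordinal d0)) /eqP; rewrite !mxE !eqxx oner_eq0.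
have sub0 : RN Y *m top 0 c0 = y *: top 0 c0.
  exact/subr0_eq/extension_hypercharge_top.
case: (preim U hU) (preim V hV) => [U0|U1] [V0|V1].
(* If both summands missed the eigenspace, the two components of an eigenvector, again killed by Y -
   y, would be zero. *)
- have : top 0 c0 \in (U + V)%VS by rewrite UV memvf.
  case/memv_addP => u uU [v vV e].
  have hu : RN Y *m u - y *: u = 0.
    apply/eqP; rewrite -memv0 -UV0 memv_cap memvB ?memvZ ?hU //=.
    have : RN Y *m u - y *: u = - (RN Y *m v - y *: v).
      apply/eqP; rewrite -addr_eq0 addrACA -opprD -mulmxDr -scalerDr -e.
      by rewrite sub0 subrr.
    by move=> ->; rewrite memvN memvB ?memvZ ?hV.
  have hv : RN Y *m v - y *: v = 0.
    rewrite (_ : v = top 0 c0 - u); last by rewrite e addrC addKr.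
    by rewrite mulmxBr scalerBr sub0 (subr0_eq hu) subrr.
  have [c1 e1] := extension_hypercharge_eigen (subr0_eq hu).
  have [c2 e2] := extension_hypercharge_eigen (subr0_eq hv).
  have /top_inj c00 : top 0 c0 = 0.
    by rewrite e e1 e2 (U0 c1) -?e1 // (V0 c2) -?e2 // !linear0 addr0.
  by rewrite c00 eqxx in c0n.
- by left; apply: (extension_summand hU hV).
- by right; apply: (extension_summand hV hU); rewrite // ?[(V + U)%VS]addvC // capvC.
- have : top 0 c0 \in (U :&: V)%VS by rewrite memv_cap U1 V1.
  by rewrite UV0 memv0 => /eqP /top_inj c00; rewrite c00 eqxx in c0n.
Qed.


End Indecomposable.

(** * The filtration *)

Section Filtration.
Context {K : numFieldType} {D N : nat}.

Lemma first_blocks0 : first_blocks K D N 0 = 0%VS.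
Proof.
apply/eqP; rewrite -subv0; apply/subvP => w /mem_first_blocks h.
by rewrite memv0; apply/eqP/blk_inj => n; rewrite h // linear0.
Qed.

Lemma first_blocks_sub k l : (k <= l)%N ->
  (first_blocks K D N k <= first_blocks K D N l)%VS.
Proof.
move=> kl; apply/subvP => w /mem_first_blocks h.
by apply/mem_first_blocks => n /(leq_trans kl) /h.
Qed.

Lemma blk_block_incl k (v : 'cV[K]_(block_dim k D)) n : (k <= N)%N ->
  blk n (block_incl K D k N v) = blk n v.
Proof.
move=> kN; rewrite blk_incl; case: ltnP => // Nn.
by rewrite blk_ge // (leq_trans kN).
Qed.

Lemma block_incl_inj k : (k <= N)%N -> injective (block_incl K D k N).
Proof.
by move=> kN v v' e; apply: blk_inj => n; rewrite -!(blk_block_incl _ _ kN) e.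
Qed.

Lemma mem_first_blocks_incl k w : (k <= N)%N ->
  w \in first_blocks K D N k <-> exists v, w = block_incl K D k N v.
Proof.
move=> kN; split=> [/mem_first_blocks h|[v ->]]; last first.
  by apply/mem_first_blocks => n kn; rewrite blk_block_incl // blk_ge.
exists (of_blk k (fun n => blk n w)); apply: blk_inj => n.
by rewrite blk_block_incl // blk_of_blk; case: ltnP => // /h.
Qed.

Lemma blk_homogeneous (par : 'I_D -> bool) b (w : 'cV[K]_(block_dim N D)) n :
  homogeneous_vec (@block_parity D N par) b w -> homogeneous_vec par b (blk n w).
Proof.
move=> hw i; have [nN|nN] := ltnP n N; last by rewrite blk_ge // mxE eqxx.
rewrite (_ : n = Ordinal nN :> nat) // blk_ord mxE => /hw <-.
by congr par; apply: val_inj; rewrite tagnat.Rank2K.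
Qed.

End Filtration.

(** * Successive quotients, read off a single block *)

Section QuotientOfBlocks.
Context {K : numFieldType} {D N : nat} (k : nat) (kN : (k < N)%N).

Local Notation W := (first_blocks K D N).

Definition quotient_blk (q : quotient_space (W k.+1) (W k)) : 'cV[K]_D :=
  blk k (vsval (repr q)).

(** Blocks are numbered from 0: in [W k.+1] all blocks after block [k] vanish, so block [k] alone
    decides membership in [W k]. Hence [quotient_blk] does not depend on the representative. *)
Lemma eq_qclass (w w' : subvs_of (W k.+1)) :
  (qclass (W k) w == qclass (W k) w') = (blk k (vsval w) == blk k (vsval w')).
Proof.
rewrite -[LHS]Quotient.idealrBE unfold_in /rel_sub linearB /=.
apply/mem_first_blocks/eqP => [/(_ _ (leqnn k))|h n].
  by rewrite linearB => /subr0_eq.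
rewrite leq_eqVlt linearB /= => /predU1P [<-|kn]; first by rewrite h subrr.
by rewrite !(mem_first_blocks _ _ (subvsP _)) // subrr.
Qed.

Lemma quotient_blkE (w : subvs_of (W k.+1)) :
  quotient_blk (qclass (W k) w) = blk k (vsval w).
Proof. by apply/eqP; rewrite -eq_qclass /qclass reprK. Qed.

Lemma in_blk_first_blocks z : in_blk N k z \in W k.+1.
Proof.
by apply/mem_first_blocks => n kn; rewrite blk_in_blk // gtn_eqF.
Qed.

Lemma quotient_blk_bij : bijective quotient_blk.
Proof.
exists (fun z => qclass (W k) (vsproj (W k.+1) (in_blk N k z))) => [q|z].
  elim/quotP: q => w _; rewrite [quotient_blk _]quotient_blkE.
  apply/eqP; rewrite -[_ == _]/(_ == qclass (W k) w) eq_qclass.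
  by rewrite vsprojK ?in_blk_first_blocks // blk_in_blk // eqxx.
by rewrite quotient_blkE vsprojK ?in_blk_first_blocks // blk_in_blk // eqxx.
Qed.

End QuotientOfBlocks.

Section FiltrationModules.
Context {K : numFieldType} {g : superalgebra} {d r D : nat}.
Context (hg : admissible g) {lam : gl K g -> 'M[K]_d} {vs : r.-tuple (gl K g)}.
Context (hvs : is_basis_gm1 vs).
Context {num : 'I_D -> {set 'I_r} * 'I_d} (hnum : bijective num).
Context {rho : K -> gl K g -> 'M[K]_D} {y : K}.
Context (hrho : forall t, is_kac_matrices lam t vs num (rho t)).
Context {N : nat} {RN : gl K g -> 'M[K]_(block_dim N D)}.
Context (hRN : is_extension rho y RN).

Lemma first_blocks_submodule k :
  submodule (in_g K g) RN (first_blocks K D N k).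
Proof.
move=> x w gx /mem_first_blocks h; apply/mem_first_blocks => n kn.
rewrite (blk_extension hg hvs hnum hrho hRN) // !h ?mulmx0 ?addr0 //.
exact: leq_trans kn _.
Qed.

(** The formula for a block of the image does not mention the number of blocks. *)
Lemma block_incl_extension k (Rk : gl K g -> 'M[K]_(block_dim k D)) x v :
  is_extension rho y Rk -> (k <= N)%N -> in_g K g x ->
  RN x *m block_incl K D k N v = block_incl K D k N (Rk x *m v).
Proof.
move=> hRk kN gx; apply: blk_inj => n; rewrite blk_block_incl //.
rewrite (blk_extension hg hvs hnum hrho hRN) // !blk_block_incl //.
by rewrite (blk_extension hg hvs hnum hrho hRk).
Qed.

(** The slope term in row [k] acts on block [k.+1], which is zero on the larger subspace, so only
    [rho y] remains. *)
Lemma first_blocks_quotient k : (k < N)%N ->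
  quotient_iso (block_parity (kac_parity num)) RN
    (first_blocks K D N k.+1) (first_blocks K D N k) (kac_parity num) (rho y).
Proof.
move=> kN; exists (@quotient_blk K D N k); split.
- exact: quotient_blk_bij.
- by move=> c w w'; rewrite !quotient_blkE // linearD linearZ_LR.
- move=> x w gx; rewrite !quotient_blkE //.
  rewrite vsprojK; last by apply: first_blocks_submodule; rewrite ?subvsP.
  rewrite (blk_extension hg hvs hnum hrho hRN) //.
  by rewrite [blk k.+1 _](mem_first_blocks _ _ (subvsP _)) // mulmx0 addr0.
- by move=> b w hw; rewrite quotient_blkE //; apply: blk_homogeneous.
Qed.

End FiltrationModules.

Theorem mainTheorem1 (R : realType) (g : superalgebra) (hg : admissible g)
  (a : simple_root g -> nat) (y : R[i])
  (d : nat) (lam : gl R[i] g -> 'M[R[i]]_d) (hlam : is_irreducible_hw a lam)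
  (r : nat) (vs : r.-tuple (gl R[i] g)) (hvs : is_basis_gm1 vs)
  (D : nat) (num : 'I_D -> {set 'I_r} * 'I_d) (hnum : bijective num)
  (rho : R[i] -> gl R[i] g -> 'M[R[i]]_D)
  (hrho : forall t : R[i], is_kac_matrices lam t vs num (rho t)) :
  (forall N : nat, (0 < N)%N ->
     exists RN : gl R[i] g -> 'M[R[i]]_(block_dim N D), is_extension rho y RN) /\
  (forall RR : forall N : nat, gl R[i] g -> 'M[R[i]]_(block_dim N D),
     (forall N : nat, (0 < N)%N -> is_extension rho y (RR N)) ->
     forall N : nat, (0 < N)%N ->
       [/\ is_rep (in_g R[i] g) (RR N),
           respects_parity (in_g R[i] g) (block_parity (kac_parity num)) (RR N),
           indecomposable (in_g R[i] g) (RR N),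
           block_dim N D = (N * D)%N &
           first_blocks R[i] D N 0 = 0%VS /\
           forall k : nat, (1 <= k <= N)%N ->
             let W := first_blocks R[i] D N in
             [/\ submodule (in_g R[i] g) (RR N) (W k),
                 injective (block_incl R[i] D k N) /\
                 (forall w, w \in W k <-> exists v, w = block_incl R[i] D k N v),
                 forall x v, in_g R[i] g x ->
                   RR N x *m block_incl R[i] D k N v =
                   block_incl R[i] D k N (RR k x *m v),
                 (W k.-1 <= W k)%VS &
                 quotient_iso (block_parity (kac_parity num)) (RR N)
                   (W k) (W k.-1) (kac_parity num) (rho y)]]).
Proof.
split=> [N _|RR hRR N N0].
  eexists; exact: (extension_upper_block hg hvs hnum (y := y) hrho N).
split.
- exact: (extension_rep hg hvs hnum hrho (hRR N N0)).
- exact: (extension_parity hg hvs hnum hrho (hRR N N0)).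
- exact: (extension_indecomposable hg hvs hnum hrho N0 (hRR N N0) hlam).
- by rewrite sum_nat_const card_ord.
split=> [|[|k] // /andP [_ kN]]; first exact: first_blocks0.
split.
- exact: (first_blocks_submodule hg hvs hnum hrho (hRR N N0)).
- by split; [exact: block_incl_inj|move=> w; exact: mem_first_blocks_incl].
- move=> x v gx.
  exact: (block_incl_extension hg hvs hnum hrho (hRR N N0) v (hRR k.+1 _)).
- exact: first_blocks_sub.
- exact: (first_blocks_quotient hg hvs hnum hrho (hRR N N0)).
Qed.
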